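(* Let $D=\left(\frac{a,\pi}{K}\right)$ be a quaternion division algebra over $K$ with $a\in\mathcal{O}_K^*$, with $K$-basis $1,x,y,z$ where $x^2=a$, $y^2=\pi$, $z=xy=-yx$, and let $\tau$ be its canonical involution. Then every hermitian form over $(D,\tau)$ is unramified, Larmour's isomorphism is an isomorphism $$\partial_0: W^{1}\left(\left(\tfrac{a,\pi}{K}\right),\tau\right)\cong W^{1}(k(\overline x),\iota),$$ and for $\delta\in\mathcal{O}_K^*$ the image of the one-dimensional hermitian form $\langle\delta\rangle$ under $\partial_0$ is $\langle\overline\delta\rangle$.
   Context: $K$ is a complete discretely valued field with normalized valuation $\nu_K$, valuation ring $\mathcal{O}_K$, uniformizer $\pi$ and residue field $k$ of characteristic $\neq2$. $\nu_D(d)=\frac12\nu_K(\mathrm{Nrd}(d))$ extends $\nu_K$ to $D$; $\mathcal{O}_D=\{\nu_D\ge0\}$, $m_D=\{\nu_D>0\}$ (both with $0$), $\overline D=\mathcal{O}_D/m_D$, and a bar denotes reduction modulo $m_D$. Here $\nu_D$ has value group $\frac12\mathbb{Z}$ and $\overline D\cong k(\overline x)$, a quadratic field extension of $k$ with $\overline x^2=\overline a$; $\iota$ is its nontrivial $k$-automorphism. The involution $\tau$ ($\tau(x)=-x$, $\tau(y)=-y$, $\tau(z)=-z$) induces $\overline\tau=\iota$ on $\overline D$. $W^\epsilon(E,\rho)$ is the Witt group of nondegenerate $\epsilon$-hermitian forms over a division algebra with involution $(E,\rho)$, and $\langle u_1,\dots,u_r\rangle$ is the diagonal form with $\rho(u_i)=\epsilon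 u_i$. A form over $(D,\sigma)$ is unramified if it is isometric to some $\langle u_1,\dots,u_r\rangle$ with all $\nu_D(u_i)=0$; for such a form $h$ put $\overline h=\langle\overline{u_1},\dots,\overline{u_r}\rangle$, an $\epsilon$-hermitian form over $(\overline D,\overline\sigma)$. When every $\epsilon$-hermitian form over $(D,\sigma)$ is unramified, Larmour's isomorphism is the (well-defined) map $\partial_0:W^\epsilon(D,\sigma)\to W^\epsilon(\overline D,\overline\sigma)$, $[h]\mapsto[\overline h]$. *)

(* Defs.v *)
From HB Require Import structures.
From mathcomp Require Import all_boot all_order all_algebra.
From mathcomp Require Import generic_quotient ring_quotient boolp.
From mathcomp Require Import ring zify.

Set Implicit Arguments.
Unset Strict Implicit.
Unset Printing Implicit Defensive.
Import Order.TTheory GRing.Theory Num.Theory.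
Local Open Scope ring_scope.
Local Open Scope quotient_scope.

(* An involution is an anti-automorphism of order at most two; the *)
(* characteristic is different from 2 throughout. *)
Record divInv := DivInv {
  divInv_sort :> unitRingType;
  divInv_field : forall x : divInv_sort, x != 0 -> x \is a GRing.unit;
  invol : divInv_sort -> divInv_sort;
  conjD : {morph invol : x y / x + y};
  conjM : forall x y, invol (x * y) = invol y * invol x;
  conjK : involutive invol;
  divInv_char : (2%:R : divInv_sort) != 0
}.
Arguments invol {d}.

Section Conj.
Variable E : divInv.
Implicit Types x y : E.

Lemma conj0 : invol (0 : E) = 0.
Proof. by apply: (addIr (invol 0)); rewrite -conjD !add0r. Qed.

Lemma conjN x : invol (- x) = - invol x.
Proof. by apply: (addIr (invol x)); rewrite -conjD !addNr conj0. Qed.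

Lemma conj1 : invol (1 : E) = 1.
Proof. by rewrite -[RHS]conjK -(mulr1 (invol 1)) conjM conjK mulr1. Qed.

Lemma conj_sum I (r : seq I) P (F : I -> E) :
  invol (\sum_(i <- r | P i) F i) = \sum_(i <- r | P i) invol (F i).
Proof. exact: (big_morph _ (@conjD E) conj0). Qed.

Definition ctr m n (M : 'M[E]_(m, n)) : 'M[E]_(n, m) := map_mx invol M^T.

Lemma ctrK m n (M : 'M[E]_(m, n)) : ctr (ctr M) = M.
Proof. by apply/matrixP => i j; rewrite !mxE conjK. Qed.

Lemma ctr_mul m n p (M : 'M[E]_(m, n)) (N : 'M[E]_(n, p)) :
  ctr (M *m N) = ctr N *m ctr M.
Proof.
apply/matrixP => i j; rewrite !mxE conj_sum; apply: eq_bigr => k _.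
by rewrite conjM !mxE.
Qed.

Lemma ctr0 m n : ctr (0 : 'M_(m, n)) = 0.
Proof. by apply/matrixP => i j; rewrite !mxE conj0. Qed.

Lemma ctrN m n (M : 'M_(m, n)) : ctr (- M) = - ctr M.
Proof. by apply/matrixP => i j; rewrite !mxE conjN. Qed.

Lemma ctr1 n : ctr (1%:M : 'M_n) = 1%:M.
Proof.
apply/matrixP => i j; rewrite !mxE eq_sym.
by case: eqP; rewrite ?conj1 ?conj0.
Qed.

Lemma ctr_block m1 m2 n1 n2 (A : 'M_(m1, n1)) (B : 'M_(m1, n2))
    (C : 'M_(m2, n1)) (D : 'M_(m2, n2)) :
  ctr (block_mx A B C D) = block_mx (ctr A) (ctr C) (ctr B) (ctr D).
Proof. by rewrite /ctr tr_block_mx map_block_mx. Qed.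

(* A nondegenerate hermitian form, given by its Gram matrix: on the *)
(* right vector space E^n the form is h(v, w) = ctr v *m gram *m w. *)
(* Nondegeneracy is bijectivity of the adjoint map E^n -> (E^n)^*, that *)
(* is, invertibility of the Gram matrix; [unitmx] is not available over *)
(* a noncommutative ring. *)
Record hform := HForm {
  dimf : nat;
  gram : 'M[E]_dimf;
  gram_herm : ctr gram = gram;
  gram_nondeg : exists N, gram *m N = 1%:M /\ N *m gram = 1%:M
}.

HB.instance Definition _ := gen_eqMixin hform.
HB.instance Definition _ := gen_choiceMixin hform.

Implicit Types h : hform.

(* The dimensions are not assumed equal a priori, which avoids casts. *)
Definition isometric h h' :=
  exists (P : 'M_(dimf h, dimf h')) (Q : 'M_(dimf h', dimf h)),
    [/\ P *m Q = 1%:M, Q *m P = 1%:M & gram h' = ctr P *m gram h *m P].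

Lemma osum_herm h h' :
  ctr (block_mx (gram h) 0 0 (gram h')) = block_mx (gram h) 0 0 (gram h').
Proof. by rewrite ctr_block !ctr0 !gram_herm. Qed.

Lemma osum_nondeg h h' : let M := block_mx (gram h) 0 0 (gram h') in
  exists N, M *m N = 1%:M /\ N *m M = 1%:M.
Proof.
have [N [MN NM]] := gram_nondeg h; have [N' [MN' NM']] := gram_nondeg h'.
exists (block_mx N 0 0 N'); rewrite !mulmx_block !mulmx0 !mul0mx.
by rewrite !addr0 !add0r MN NM MN' NM' -scalar_mx_block.
Qed.

Definition osum h h' := HForm (osum_herm h h') (osum_nondeg h h').

Lemma hyp_herm n : ctr (block_mx 0 1%:M 1%:M 0 : 'M_(n + n)) =
  block_mx 0 1%:M 1%:M 0.
Proof. by rewrite ctr_block !ctr0 !ctr1. Qed.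

Lemma hyp_nondeg n : let M := block_mx 0 1%:M 1%:M 0 : 'M[E]_(n + n) in
  exists N, M *m N = 1%:M /\ N *m M = 1%:M.
Proof.
exists (block_mx 0 1%:M 1%:M 0); rewrite !mulmx_block !mulmx0 !mul0mx.
by rewrite !mulmx1 !addr0 !add0r -scalar_mx_block.
Qed.

(* The orthogonal sum of n hyperbolic planes. *)
Definition hyp n := HForm (hyp_herm n) (hyp_nondeg n).

Lemma opp_herm h : ctr (- gram h) = - gram h.
Proof. by rewrite ctrN gram_herm. Qed.

Lemma opp_nondeg h : exists N, - gram h *m N = 1%:M /\ N *m - gram h = 1%:M.
Proof.
have [N [MN NM]] := gram_nondeg h.
by exists (- N); rewrite !mulmxN !mulNmx !opprK.
Qed.

Definition oppf h := HForm (opp_herm h) (opp_nondeg h).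

Lemma isom_refl h : isometric h h.
Proof. by exists 1%:M, 1%:M; rewrite ctr1 !mulmx1 mul1mx. Qed.

Lemma isom_sym h h' : isometric h h' -> isometric h' h.
Proof.
move=> [P [Q [PQ QP e]]]; exists Q, P; split=> //.
by rewrite e !mulmxA -ctr_mul PQ ctr1 mul1mx -mulmxA PQ mulmx1.
Qed.

Lemma isom_trans h h' h'' :
  isometric h h' -> isometric h' h'' -> isometric h h''.
Proof.
move=> [P [Q [PQ QP e]]] [P' [Q' [PQ' QP' e']]].
exists (P *m P'), (Q' *m Q); split.
- by rewrite -mulmxA (mulmxA P') PQ' mul1mx.
- by rewrite -mulmxA (mulmxA Q) QP mul1mx.
- by rewrite e' e ctr_mul !mulmxA.
Qed.

Lemma isom_osum h1 h1' h2 h2' : isometric h1 h1' -> isometric h2 h2' ->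
  isometric (osum h1 h2) (osum h1' h2').
Proof.
move=> [P [Q [PQ QP e]]] [P' [Q' [PQ' QP' e']]].
exists (block_mx P 0 0 P'), (block_mx Q 0 0 Q'); split=> /=;
  rewrite ?ctr_block ?ctr0 !mulmx_block !mulmx0 !mul0mx !addr0 !add0r.
- by rewrite PQ PQ' -scalar_mx_block.
- by rewrite QP QP' -scalar_mx_block.
- by rewrite ?mul0mx ?addr0 e e'.
Qed.

Lemma isom_osumC h h' : isometric (osum h h') (osum h' h).
Proof.
exists (block_mx 0 1%:M 1%:M 0), (block_mx 0 1%:M 1%:M 0); split=> /=;
  rewrite ?ctr_block ?ctr0 ?ctr1 !mulmx_block ?mulmx0 ?mul0mx ?mulmx1 ?mul1mx
  ?addr0 ?add0r ?mulmx0 ?mul0mx ?mulmx1 ?mul1mx ?addr0 -?scalar_mx_block //.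
Qed.

Lemma isom_cast h h' (e : dimf h = dimf h') :
  gram h' = castmx (e, e) (gram h) -> isometric h h'.
Proof.
case: h h' e => [n M hM rM] [n' M' hM' rM'] /= e; case: n' / e M' hM' rM'.
move=> M' hM' rM'; rewrite castmx_id /= => eM; rewrite /isometric /=.
by exists 1%:M, 1%:M; rewrite ctr1 !mulmx1 mul1mx.
Qed.

Lemma isom_osumA h1 h2 h3 :
  isometric (osum h1 (osum h2 h3)) (osum (osum h1 h2) h3).
Proof.
apply: (@isom_cast (osum h1 (osum h2 h3)) (osum (osum h1 h2) h3) (addnA _ _ _)).
have := @block_mxA E _ _ _ _ _ _ (gram h1) 0 0 0 (gram h2) 0 0 0 (gram h3).
rewrite /= !row_mx0 !col_mx0 => ->.
by rewrite castmx_comp castmx_id.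
Qed.

Lemma isom_hypD m n : isometric (hyp (m + n)) (osum (hyp m) (hyp n)).
Proof.
pose P : 'M[E]_((m + n) + (m + n), (m + m) + (n + n)) :=
  block_mx (block_mx 1%:M 0 0 0) (block_mx 0 0 1%:M 0)
           (block_mx 0 1%:M 0 0) (block_mx 0 0 0 1%:M).
exists P, (ctr P); split=> /=; rewrite /P !ctr_block !ctr0 !ctr1.
- rewrite !mulmx_block !(mulmx0, mul0mx, mulmx1, mul1mx, addr0, add0r,
    add_block_mx) ?block_mx0.
  by rewrite !scalar_mx_block ?block_mx0.
- rewrite !mulmx_block !(mulmx0, mul0mx, mulmx1, mul1mx, addr0, add0r,
    add_block_mx) ?block_mx0.
  by rewrite !scalar_mx_block ?block_mx0.
- rewrite scalar_mx_block !mulmx_block.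
  by rewrite !(mulmx0, mul0mx, mulmx1, mul1mx, addr0, add0r,
    add_block_mx, mulmx_block) ?block_mx0.
Qed.

Lemma hyp0l h : isometric (osum h (hyp 0)) h.
Proof.
exists (col_mx 1%:M 0), (row_mx 1%:M 0); split=> /=.
- rewrite mul_col_row !mulmx1 mulmx0 mul0mx.
  by rewrite scalar_mx_block; congr block_mx; apply/matrixP => - [].
- by rewrite mul_row_col mulmx1 mulmx0 addr0.
- rewrite /ctr tr_col_mx map_row_mx -!/(ctr _) ctr1 ctr0.
  by rewrite mul_row_block mul_row_col !(mul1mx, mulmx0, mul0mx, addr0, mulmx1).
Qed.

Let half : E := (2%:R)^-1.

Lemma half2 : half + half = 1.
Proof.
by rewrite -[half]mul1r -mulrDl -(natrD _ 1 1) mulrV // divInv_field ?divInv_char.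
Qed.

Lemma half_comm x : half * x = x * half.
Proof.
have u2 : (2%:R : E) \is a GRing.unit by rewrite divInv_field ?divInv_char.
by apply: (mulrI u2); rewrite mulVKr // mulrA -commr_nat mulrK.
Qed.

Lemma conj_half : invol half = half.
Proof.
have u2 : (2%:R : E) \is a GRing.unit by rewrite divInv_field ?divInv_char.
apply: (mulrI u2); rewrite mulrV // mulr_natl mulr2n -conjD half2 conj1 //.
Qed.

Lemma scale_halfAr m n p (M : 'M[E]_(m, n)) (N : 'M_(n, p)) :
  M *m (half *: N) = half *: (M *m N).
Proof.
apply/matrixP => i j; rewrite !mxE mulr_sumr; apply: eq_bigr => k _.
by rewrite !mxE !mulrA half_comm.
Qed.

Lemma ctr_half m n (M : 'M_(m, n)) : ctr (half *: M) = half *: ctr M.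
Proof.
by apply/matrixP => i j; rewrite !mxE conjM conj_half half_comm.
Qed.

Lemma isom_osumN h : isometric (osum h (oppf h)) (hyp (dimf h)).
Proof.
have [N [MN NM]] := gram_nondeg h; set M := gram h in MN NM.
have NH : ctr N = N.
  have NM' : ctr N *m M = 1%:M by rewrite -[M]gram_herm -ctr_mul MN ctr1.
  by rewrite -[ctr N]mulmx1 -MN mulmxA NM' mul1mx.
have h2 m n (A : 'M[E]_(m, n)) : half *: A + half *: A = A.
  by rewrite -scalerDl half2 scale1r.
exists (block_mx 1%:M (half *: N) 1%:M (- (half *: N))).
exists (block_mx (half *: 1%:M) (half *: 1%:M) M (- M)); split=> /=.
- rewrite !mulmx_block !mulNmx !mulmxN -!scalemxAl NM !mul1mx !opprK !h2 !subrr.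
  by rewrite -scalar_mx_block.
- rewrite !mulmx_block !mulNmx !mulmxN -!scalemxAl !scale_halfAr MN !mul1mx.
  by rewrite ?mulmx1 !opprK !h2 !subrr -scalar_mx_block.
- rewrite ctr_block !ctrN !ctr_half NH ctr1 -/M !mulmx_block.
  rewrite !(mulmx0, addr0, add0r, mulNmx, mulmxN, mul1mx, mulmx1, opprK).
  rewrite -!scalemxAl NM !(mul1mx, mulmx1, scale_halfAr, MN, mulmxN, opprK, h2).
  by rewrite !subrr ?mul1mx -?scalerN ?subrr ?h2.
Qed.

(* Witt equivalence: isometry up to orthogonal sums of hyperbolic planes. *)
Definition witt_equiv h h' :=
  exists m n, isometric (osum h (hyp m)) (osum h' (hyp n)).

Lemma isom_osumAC h1 h2 h3 :
  isometric (osum (osum h1 h2) h3) (osum (osum h1 h3) h2).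
Proof.
apply: isom_trans (isom_sym (isom_osumA _ _ _)) _.
apply: isom_trans (isom_osumA _ _ _).
exact: isom_osum (isom_refl _) (isom_osumC _ _).
Qed.

Lemma isom_osumACA h1 h2 h3 h4 :
  isometric (osum (osum h1 h2) (osum h3 h4)) (osum (osum h1 h3) (osum h2 h4)).
Proof.
apply: isom_trans (isom_osumA _ _ _) _; apply: isom_sym.
apply: isom_trans (isom_osumA _ _ _) _.
exact: isom_osum (isom_osumAC _ _ _) (isom_refl _).
Qed.

Lemma isom_osum_hypD h m n :
  isometric (osum (osum h (hyp m)) (hyp n)) (osum h (hyp (m + n))).
Proof.
apply: isom_trans (isom_sym (isom_osumA _ _ _)) _.
exact: isom_osum (isom_refl _) (isom_sym (isom_hypD _ _)).
Qed.

Lemma witt_refl h : witt_equiv h h.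
Proof. by exists 0%N, 0%N; exact: isom_refl. Qed.

Lemma isom_witt h h' : isometric h h' -> witt_equiv h h'.
Proof. by move=> e; exists 0%N, 0%N; apply: isom_osum => //; exact: isom_refl. Qed.

Lemma witt_sym h h' : witt_equiv h h' -> witt_equiv h' h.
Proof. by move=> [m [n e]]; exists n, m; exact: isom_sym. Qed.

Lemma witt_trans h h' h'' :
  witt_equiv h h' -> witt_equiv h' h'' -> witt_equiv h h''.
Proof.
move=> [m [n e]] [p [q e']]; exists (m + p)%N, (q + n)%N.
apply: isom_trans (isom_sym (isom_osum_hypD _ _ _)) _.
apply: isom_trans (isom_osum e (isom_refl _)) _.
apply: isom_trans (isom_osumAC _ _ _) _.
apply: isom_trans (isom_osum e' (isom_refl _)) _.
exact: isom_osum_hypD.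
Qed.

Lemma witt_osum h1 h1' h2 h2' : witt_equiv h1 h1' -> witt_equiv h2 h2' ->
  witt_equiv (osum h1 h2) (osum h1' h2').
Proof.
move=> [m [n e]] [p [q e']]; exists (m + p)%N, (n + q)%N.
have T k k' s t : isometric (osum (osum k k') (hyp (s + t)))
                            (osum (osum k (hyp s)) (osum k' (hyp t))).
  apply: isom_trans (isom_osumACA _ _ _ _).
  exact: isom_osum (isom_refl _) (isom_hypD _ _).
apply: isom_trans (T _ _ _ _) _.
apply: isom_trans (isom_osum e e') _.
exact: isom_sym (T _ _ _ _).
Qed.

Lemma witt_osumN h : witt_equiv (osum h (oppf h)) (hyp 0).
Proof.
exists 0%N, (dimf h); apply: isom_trans (isom_osumC _ _).
exact: isom_osum (isom_osumN h) (isom_refl _).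
Qed.

Lemma witt_osum0 h : witt_equiv (osum (hyp 0) h) h.
Proof.
by apply: isom_witt; apply: isom_trans (isom_osumC _ _) _; exact: hyp0l.
Qed.

Lemma witt_opp h h' : witt_equiv h h' -> witt_equiv (oppf h) (oppf h').
Proof.
move=> e; apply: witt_trans (witt_sym (witt_osum0 _)) _.
have e1 : witt_equiv (hyp 0) (osum (oppf h') h).
  apply: witt_trans (witt_sym (witt_osumN h')) _.
  apply: witt_trans (isom_witt (isom_osumC _ _)) _.
  exact: witt_osum (witt_refl _) (witt_sym e).
apply: witt_trans (witt_osum e1 (witt_refl _)) _.
apply: witt_trans (isom_witt (isom_sym (isom_osumA _ _ _))) _.
apply: witt_trans (witt_osum (witt_refl _) (witt_osumN h)) _.
by apply: isom_witt; exact: hyp0l.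
Qed.

Definition witt_rel : rel hform := fun h h' => `[< witt_equiv h h' >].

Lemma witt_relP : equiv_class_of witt_rel.
Proof.
split=> [h|h h'|h' h h''].
- by apply/asboolP; exact: witt_refl.
- by apply/asboolP/asboolP => /witt_sym.
- by move=> /asboolP e /asboolP e'; apply/asboolP; exact: witt_trans e e'.
Qed.

Canonical witt_rel_equiv := EquivRelPack witt_relP.

End Conj.

(* The Witt group W^1(E, invol): addition is induced by orthogonal sum. *)
Definition witt (E : divInv) := {eq_quot (@witt_rel E)}.
HB.instance Definition _ E := EqQuotient.on (witt E).
HB.instance Definition _ E := Choice.on (witt E).

Definition witt_class (E : divInv) (h : hform E) : witt E := \pi_(witt E) h.

Section WittGroup.
Variable E : divInv.
Implicit Types (h : hform E) (w : witt E).

Lemma witt_classP h h' : witt_class h = witt_class h' <-> witt_equiv h h'.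
Proof. by split=> [/eqmodP/asboolP|/asboolP e]; last exact/eqmodP. Qed.

Lemma witt_classK w : witt_class (repr w) = w.
Proof. exact: reprK. Qed.

Lemma witt_repr h : witt_equiv (repr (witt_class h)) h.
Proof. by apply/witt_classP; rewrite witt_classK. Qed.

Definition witt_zero : witt E := witt_class (hyp E 0).
Definition witt_add w w' := witt_class (osum (repr w) (repr w')).
Definition witt_neg w := witt_class (oppf (repr w)).

Lemma witt_addE h h' :
  witt_add (witt_class h) (witt_class h') = witt_class (osum h h').
Proof. by apply/witt_classP; apply: witt_osum; exact: witt_repr. Qed.

Lemma witt_negE h : witt_neg (witt_class h) = witt_class (oppf h).
Proof. by apply/witt_classP; apply: witt_opp; exact: witt_repr. Qed.

Lemma witt_addA : associative witt_add.
Proof.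
move=> u v w; rewrite -(witt_classK u) -(witt_classK v) -(witt_classK w).
by rewrite !witt_addE; apply/witt_classP/isom_witt; exact: isom_osumA.
Qed.

Lemma witt_addC : commutative witt_add.
Proof.
move=> u v; rewrite -(witt_classK u) -(witt_classK v) !witt_addE.
by apply/witt_classP/isom_witt; exact: isom_osumC.
Qed.

Lemma witt_add0 : left_id witt_zero witt_add.
Proof.
move=> u; rewrite -(witt_classK u) witt_addE.
by apply/witt_classP; exact: witt_osum0.
Qed.

Lemma witt_addN : left_inverse witt_zero witt_neg witt_add.
Proof.
move=> u; rewrite witt_addC -(witt_classK u) witt_negE witt_addE.
by apply/witt_classP; exact: witt_osumN.
Qed.

HB.instance Definition _ :=
  GRing.isZmodule.Build (witt E) witt_addA witt_addC witt_add0 witt_addN.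

Lemma witt_classD h h' :
  witt_class (osum h h') = witt_class h + witt_class h'.
Proof. by rewrite -witt_addE. Qed.

Section Diagonal.
Variables (r : nat) (u : 'rV[E]_r).
Definition diag_entries := forall i, invol (u 0 i) = u 0 i /\ u 0 i != 0.
Hypothesis hu : diag_entries.

Lemma diag_herm : ctr (diag_mx u) = diag_mx u.
Proof.
apply/matrixP => i j; rewrite !mxE eq_sym; case: eqP => [->|_].
  by rewrite !mulr1n (hu j).1.
by rewrite !mulr0n conj0.
Qed.

Lemma diag_nondeg : exists N, diag_mx u *m N = 1%:M /\ N *m diag_mx u = 1%:M.
Proof.
have U i : u 0 i \is a GRing.unit by rewrite divInv_field ?(hu i).2.
exists (diag_mx (\row_i (u 0 i)^-1)); rewrite !mulmx_diag.
by split; apply/matrixP => i j; rewrite !mxE; case: eqP => [->|_] //;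
   rewrite ?mulrV ?mulVr.
Qed.

(* The diagonal form <u_1, ..., u_r>. *)
Definition diagf := HForm diag_herm diag_nondeg.
End Diagonal.

End WittGroup.

(* The valuation is only meaningful on nonzero elements; the value of *)
(* [vald] at 0 is irrelevant. *)
Record valDiv := ValDiv {
  valDiv_sort :> unitRingType;
  valDiv_field : forall x : valDiv_sort, x != 0 -> x \is a GRing.unit;
  vald : valDiv_sort -> rat;
  valdM : forall x y, x != 0 -> y != 0 -> vald (x * y) = vald x + vald y;
  valdD : forall x y, x != 0 -> y != 0 -> x + y != 0 ->
    Num.min (vald x) (vald y) <= vald (x + y)
}.
Arguments vald {v}.

Section Residue.
Variable V : valDiv.
Implicit Types x y : V.

Lemma valDiv_mulf x y : x != 0 -> y != 0 -> x * y != 0.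
Proof.
by move=> /valDiv_field ux yN0; rewrite -(mulr0 x) (inj_eq (mulrI ux)).
Qed.

Lemma vald1 : vald (1 : V) = 0.
Proof.
apply: (addIr (vald (1 : V))).
by rewrite add0r -valdM ?oner_neq0 ?mulr1.
Qed.

Lemma valdN1 : vald (-1 : V) = 0.
Proof.
have N1 : (-1 : V) != 0 by rewrite oppr_eq0 oner_neq0.
have := valdM N1 N1; rewrite mulrNN mulr1 vald1 => /esym/eqP.
by rewrite -mulr2n mulrn_eq0 => /eqP.
Qed.

Lemma valdN x : vald (- x) = vald x.
Proof.
have [->|x0] := eqVneq x 0; first by rewrite oppr0.
by rewrite -mulN1r valdM ?oppr_eq0 ?oner_neq0 // valdN1 add0r.
Qed.

Lemma valdV x : x != 0 -> vald x^-1 = - vald x.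
Proof.
move=> x0; apply: (addrI (vald x)); rewrite -valdM ?invr_eq0 //.
by rewrite mulrV ?valDiv_field // vald1 subrr.
Qed.

Definition in_O : pred V := fun x => (x == 0) || (0 <= vald x).
Definition in_m : pred V := fun x => (x == 0) || (0 < vald x).

Lemma in_m_O x : in_m x -> in_O x.
Proof. by case/orP => [/eqP->|/ltW h]; rewrite /in_O ?eqxx // h orbT. Qed.

Lemma in_O_add x y : in_O x -> in_O y -> in_O (x + y).
Proof.
rewrite /in_O; have [->|x0] := eqVneq x 0; first by rewrite add0r.
have [->|y0] := eqVneq y 0; first by rewrite addr0 (negPf x0).
have [//|s0 /= hx hy] := eqVneq (x + y) 0.
by apply: le_trans (valdD x0 y0 s0); rewrite le_min hx hy.
Qed.

Lemma in_m_add x y : in_m x -> in_m y -> in_m (x + y).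
Proof.
rewrite /in_m; have [->|x0] := eqVneq x 0; first by rewrite add0r.
have [->|y0] := eqVneq y 0; first by rewrite addr0 (negPf x0).
have [//|s0 /= hx hy] := eqVneq (x + y) 0.
by apply: lt_le_trans (valdD x0 y0 s0); rewrite lt_min hx hy.
Qed.

Lemma in_O_mul x y : in_O x -> in_O y -> in_O (x * y).
Proof.
rewrite /in_O; have [->|x0] := eqVneq x 0; first by rewrite mul0r eqxx.
have [->|y0] := eqVneq y 0; first by rewrite mulr0 eqxx.
by move=> /= hx hy; rewrite valdM // addr_ge0 ?orbT.
Qed.

Lemma in_m_mull x y : in_O x -> in_m y -> in_m (x * y).
Proof.
rewrite /in_m /in_O; have [->|x0] := eqVneq x 0; first by rewrite mul0r eqxx.
have [->|y0] := eqVneq y 0; first by rewrite mulr0 eqxx.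
by move=> /= hx hy; rewrite valdM // ltr_wpDl ?orbT.
Qed.

Lemma in_m_mulr x y : in_m x -> in_O y -> in_m (x * y).
Proof.
rewrite /in_m /in_O; have [->|x0] := eqVneq x 0; first by rewrite mul0r eqxx.
have [->|y0] := eqVneq y 0; first by rewrite mulr0 eqxx.
by move=> /= hx hy; rewrite valdM // ltr_wpDr ?orbT.
Qed.

Lemma in_O_opp x : in_O (- x) = in_O x.
Proof. by rewrite /in_O oppr_eq0 valdN. Qed.

Lemma in_m_opp x : in_m (- x) = in_m x.
Proof. by rewrite /in_m oppr_eq0 valdN. Qed.

Lemma in_O0 : in_O 0. Proof. by rewrite /in_O eqxx. Qed.
Lemma in_O1 : in_O 1. Proof. by rewrite /in_O vald1 lexx orbT. Qed.
Lemma in_m0 : in_m 0. Proof. by rewrite /in_m eqxx. Qed.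
Lemma in_m1 : in_m 1 = false.
Proof. by rewrite /in_m vald1 ltxx oner_eq0. Qed.

Lemma in_O_inv x : in_O x -> ~~ in_m x -> in_O x^-1.
Proof.
rewrite /in_O /in_m negb_or -leNgt => + /andP[x0 h1].
by rewrite (negPf x0) /= => h2; rewrite valdV // oppr_ge0 h1 orbT.
Qed.

Lemma in_O_subring : subring_closed in_O.
Proof.
split=> [|x y xO yO|x y]; first exact: in_O1.
  by apply: in_O_add => //; rewrite in_O_opp.
exact: in_O_mul.
Qed.
HB.instance Definition _ := GRing.isSubringClosed.Build V in_O in_O_subring.

Record vring := VRing { vring_val : V; _ : vring_val \in in_O }.
HB.instance Definition _ := [isSub for vring_val].
HB.instance Definition _ := [Choice of vring by <:].
HB.instance Definition _ := [SubChoice_isSubNzRing of vring by <:].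

Definition max_ideal : {pred vring} := fun x : vring => in_m (vring_val x).

Lemma max_ideal_zmod : zmod_closed max_ideal.
Proof.
split=> [|x y xm ym]; first exact: in_m0.
by apply: in_m_add => //; rewrite in_m_opp.
Qed.
HB.instance Definition _ := GRing.isZmodClosed.Build vring max_ideal
  max_ideal_zmod.

Definition residue := @Quotient.quot vring max_ideal.
HB.instance Definition _ := EqQuotient.on residue.
HB.instance Definition _ := Choice.on residue.
HB.instance Definition _ := GRing.Zmodule.on residue.

Definition toO (x : V) : vring := insubd 0 x.

(* Reduction modulo the maximal ideal; it is meaningful on the valuation *)
(* ring, and sends the elements outside of it to 0. *)
Definition red (x : V) : residue := \pi_residue (toO x).

Lemma toOK x : in_O x -> vring_val (toO x) = x.
Proof. by move=> xO; rewrite /toO insubdK. Qed.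

Lemma vringP (x : vring) : in_O (vring_val x).
Proof. by case: x. Qed.

Lemma pi_red (x : vring) : \pi_residue x = red (vring_val x).
Proof. by congr (\pi_residue _); apply/val_inj; rewrite /= toOK ?vringP. Qed.

Lemma redP x y : in_O x -> in_O y -> reflect (red x = red y) (in_m (x - y)).
Proof.
move=> xO yO; have -> : in_m (x - y) = (toO x - toO y \in max_ideal).
  by rewrite -{1}(toOK xO) -{1}(toOK yO).
rewrite (@Quotient.idealrBE vring max_ideal); exact: eqP.
Qed.

Lemma red_surj (e : residue) : exists2 x, in_O x & red x = e.
Proof.
exists (vring_val (repr e)); first exact: vringP.
by rewrite -pi_red reprK.
Qed.

Definition res_lift (e : residue) : V := vring_val (repr e).
Lemma lift_O e : in_O (res_lift e). Proof. exact: vringP. Qed.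
Lemma liftK e : red (res_lift e) = e. Proof. by rewrite -pi_red reprK. Qed.

Lemma redD x y : in_O x -> in_O y -> red (x + y) = red x + red y.
Proof.
move=> xO yO; rewrite /red -[RHS](@Quotient.pi_add vring max_ideal).
by congr (\pi_residue _); apply/val_inj; rewrite /= !toOK ?in_O_add.
Qed.

Lemma redN x : in_O x -> red (- x) = - red x.
Proof.
move=> xO; rewrite /red -[RHS](@Quotient.pi_opp vring max_ideal).
by congr (\pi_residue _); apply/val_inj; rewrite /= !toOK ?in_O_opp.
Qed.

Lemma red0 : red 0 = 0.
Proof. by apply: (addIr (red 0)); rewrite -redD ?in_O0 // !add0r. Qed.

Lemma red_eq0 x : in_O x -> (red x == 0) = in_m x.
Proof.
move=> xO; rewrite -red0 -[in RHS](subr0 x).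
exact: sameP eqP (redP xO in_O0).
Qed.

Definition res_mul (e f : residue) : residue := red (res_lift e * res_lift f).

Lemma res_mulE x y : in_O x -> in_O y -> res_mul (red x) (red y) = red (x * y).
Proof.
move=> xO yO; apply/redP; rewrite ?in_O_mul ?lift_O //.
set x' := res_lift _; set y' := res_lift _.
have -> : x' * y' - x * y = (x' - x) * y' + x * (y' - y).
  by rewrite mulrBl mulrBr addrA addrNK.
have m1 : in_m (x' - x) by apply/redP; rewrite ?lift_O ?liftK.
have m2 : in_m (y' - y) by apply/redP; rewrite ?lift_O ?liftK.
by apply: in_m_add; [apply: in_m_mulr | apply: in_m_mull]; rewrite ?lift_O.
Qed.

Lemma res_mulA : associative res_mul.
Proof.
move=> e f g; rewrite -(liftK e) -(liftK f) -(liftK g).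
by rewrite !res_mulE ?in_O_mul ?lift_O // mulrA.
Qed.

Lemma res_mul1l : left_id (red 1) res_mul.
Proof.
by move=> e; rewrite -(liftK e) res_mulE ?in_O1 ?lift_O // mul1r.
Qed.

Lemma res_mul1r : right_id (red 1) res_mul.
Proof.
by move=> e; rewrite -(liftK e) res_mulE ?in_O1 ?lift_O // mulr1.
Qed.

Lemma res_mulDl : left_distributive res_mul +%R.
Proof.
move=> e f g; rewrite -(liftK e) -(liftK f) -(liftK g).
rewrite -redD ?lift_O // !res_mulE ?in_O_add ?lift_O //.
by rewrite -redD ?in_O_mul ?lift_O // mulrDl.
Qed.

Lemma res_mulDr : right_distributive res_mul +%R.
Proof.
move=> e f g; rewrite -(liftK e) -(liftK f) -(liftK g).
rewrite -redD ?lift_O // !res_mulE ?in_O_add ?lift_O //.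
by rewrite -redD ?in_O_mul ?lift_O // mulrDr.
Qed.

Lemma res_1neq0 : red 1 != 0.
Proof. by rewrite red_eq0 ?in_O1 // in_m1. Qed.

HB.instance Definition _ := GRing.Zmodule_isNzRing.Build residue
  res_mulA res_mul1l res_mul1r res_mulDl res_mulDr res_1neq0.

Lemma redM x y : in_O x -> in_O y -> red (x * y) = red x * red y.
Proof. by move=> xO yO; rewrite -res_mulE. Qed.

Lemma red1 : red 1 = 1. Proof. by []. Qed.

Definition res_unit : pred residue := fun e => e != 0.
Definition res_inv (e : residue) : residue :=
  if e == 0 then 0 else red (res_lift e)^-1.

Lemma lift_unit e : e != 0 -> res_lift e \is a GRing.unit.
Proof.
move=> e0; apply: valDiv_field; apply: contraNneq e0 => le.
by rewrite -(liftK e) le red0.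
Qed.

Lemma lift_inv_O e : e != 0 -> in_O (res_lift e)^-1.
Proof.
move=> e0; apply: in_O_inv (lift_O e) _.
by rewrite -red_eq0 ?lift_O // liftK.
Qed.

Lemma res_mulVr : {in res_unit, left_inverse 1 res_inv *%R}.
Proof.
move=> e e0; rewrite /res_inv (negPf e0) -{2}(liftK e).
by rewrite -redM ?lift_O ?lift_inv_O // mulVr // lift_unit.
Qed.

Lemma res_mulrV : {in res_unit, right_inverse 1 res_inv *%R}.
Proof.
move=> e e0; rewrite /res_inv (negPf e0) -{1}(liftK e).
by rewrite -redM ?lift_O ?lift_inv_O // mulrV // lift_unit.
Qed.

Lemma res_unitP e f : f * e = 1 /\ e * f = 1 -> res_unit e.
Proof.
by move=> [fe _]; apply/eqP => e0; move/eqP: fe; rewrite e0 mulr0 eq_sym oner_eq0.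
Qed.

Lemma res_inv_out : {in [predC res_unit], res_inv =1 id}.
Proof. by move=> e; rewrite inE negbK /res_inv => /eqP->; rewrite eqxx. Qed.

HB.instance Definition _ := GRing.NzRing_hasMulInverse.Build residue
  res_mulVr res_mulrV res_unitP res_inv_out.

Lemma res_field (e : residue) : e != 0 -> e \is a GRing.unit.
Proof. by []. Qed.

End Residue.

Record invValDiv := InvValDiv {
  invValDiv_sort :> valDiv;
  ivconj : invValDiv_sort -> invValDiv_sort;
  ivconjD : {morph ivconj : x y / x + y};
  ivconjM : forall x y, ivconj (x * y) = ivconj y * ivconj x;
  ivconjK : involutive ivconj;
  vald_conj : forall x, vald (ivconj x) = vald x;
  ivres_char : (2%:R : residue invValDiv_sort) != 0
}.
Arguments ivconj {i}.

Section ResidueInvolution.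
Variable D : invValDiv.

Lemma iv_char : (2%:R : D) != 0.
Proof.
apply: contraNneq (ivres_char D) => e.
by rewrite (natrD _ 1 1) -red1 -redD ?in_O1 // -(natrD _ 1 1) e red0.
Qed.

Definition ivdiv : divInv :=
  DivInv (@valDiv_field D) (@ivconjD D) (@ivconjM D) (@ivconjK D) iv_char.

Lemma ivconj0 : ivconj (0 : D) = 0.
Proof. by apply: (addIr (ivconj 0)); rewrite -ivconjD !add0r. Qed.

Lemma ivconj_eq0 (x : D) : (ivconj x == 0) = (x == 0).
Proof. by rewrite -{1}ivconj0 (inj_eq (can_inj (@ivconjK D))). Qed.

Lemma ivconjN (x : D) : ivconj (- x) = - ivconj x.
Proof. by apply: (addIr (ivconj x)); rewrite -ivconjD !addNr ivconj0. Qed.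

Lemma in_O_conj (x : D) : in_O (ivconj x) = in_O x.
Proof. by rewrite /in_O ivconj_eq0 vald_conj. Qed.

Lemma in_m_conj (x : D) : in_m (ivconj x) = in_m x.
Proof. by rewrite /in_m ivconj_eq0 vald_conj. Qed.

Definition res_conj (e : residue D) : residue D := red (ivconj (res_lift e)).

Lemma red_conj (x : D) : in_O x -> res_conj (red x) = red (ivconj x).
Proof.
move=> xO; apply/redP; rewrite ?in_O_conj ?lift_O //.
rewrite -ivconjN -ivconjD in_m_conj.
by apply/redP; rewrite ?lift_O ?liftK.
Qed.

Lemma res_conjD : {morph res_conj : e f / e + f}.
Proof.
move=> e f; rewrite -(liftK e) -(liftK f) -redD ?lift_O //.
by rewrite !red_conj ?in_O_add ?lift_O // ivconjD redD ?in_O_conj ?lift_O.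
Qed.

Lemma res_conjM e f : res_conj (e * f) = res_conj f * res_conj e.
Proof.
rewrite -(liftK e) -(liftK f) -redM ?lift_O //.
by rewrite !red_conj ?in_O_mul ?lift_O // ivconjM redM ?in_O_conj ?lift_O.
Qed.

Lemma res_conjK : involutive res_conj.
Proof.
by move=> e; rewrite -(liftK e) !red_conj ?in_O_conj ?lift_O // ivconjK.
Qed.

Definition ivres : divInv :=
  DivInv (@res_field D) res_conjD res_conjM res_conjK (@ivres_char D).

Section UnitDiagonal.
Variables (r : nat) (u : 'rV[D]_r).

Definition unit_entries :=
  forall i, [/\ ivconj (u 0 i) = u 0 i, u 0 i != 0 & vald (u 0 i) = 0].
Hypothesis hu : unit_entries.

Lemma unit_diag : @diag_entries ivdiv r u.
Proof. by move=> i; have [h1 h2 _] := hu i. Qed.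

Lemma res_diag : @diag_entries ivres r (map_mx (@red D) u).
Proof.
move=> i; rewrite mxE; have [h1 h2 h3] := hu i.
have uO : in_O (u 0 i) by rewrite /in_O h3 lexx orbT.
split; first by rewrite [LHS]red_conj ?h1.
by rewrite red_eq0 // /in_m negb_or h2 h3 ltxx.
Qed.

Definition unit_diagf : hform ivdiv := diagf unit_diag.
Definition res_diagf : hform ivres := diagf res_diag.
End UnitDiagonal.

Definition unramified (h : hform ivdiv) :=
  exists (r : nat) (u : 'rV[D]_r) (hu : unit_entries u),
    isometric h (unit_diagf hu).

(* d maps the class of an unramified form h = <u_1, ..., u_r> to that *)
(* of h-bar = <u_1-bar, ..., u_r-bar>. *)
Definition is_larmour (d : witt ivdiv -> witt ivres) :=
  forall (h : hform ivdiv) (r : nat) (u : 'rV[D]_r) (hu : unit_entries u),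
    isometric h (unit_diagf hu) ->
    d (witt_class h) = witt_class (res_diagf hu).

End ResidueInvolution.

(* The quaternion algebra (a, b / K): [Quat p0 p1 p2 p3] stands for *)
(* p0 + p1 x + p2 y + p3 z, where x^2 = a, y^2 = b, z = xy = -yx. *)
Record quat (K : fieldType) (a b : K) :=
  Quat { qc0 : K; qc1 : K; qc2 : K; qc3 : K }.

Section Quaternion.
Variables (K : fieldType) (a b : K).
Local Notation Q := (quat a b).
Implicit Types p q r : Q.

Definition quat_tuple p := (qc0 p, qc1 p, qc2 p, qc3 p).
Definition tuple_quat (t : K * K * K * K) : Q :=
  Quat a b t.1.1.1 t.1.1.2 t.1.2 t.2.
Lemma quat_tupleK : cancel quat_tuple tuple_quat. Proof. by case. Qed.

HB.instance Definition _ := Choice.copy Q (can_type quat_tupleK).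

Lemma quatP p q : qc0 p = qc0 q -> qc1 p = qc1 q -> qc2 p = qc2 q ->
  qc3 p = qc3 q -> p = q.
Proof. by case: p q => [????] [????] /= -> -> -> ->. Qed.

Definition qadd p q : Q :=
  Quat a b (qc0 p + qc0 q) (qc1 p + qc1 q) (qc2 p + qc2 q) (qc3 p + qc3 q).
Definition qopp p : Q := Quat a b (- qc0 p) (- qc1 p) (- qc2 p) (- qc3 p).

Lemma qaddA : associative qadd.
Proof. by move=> p q r; apply: quatP; rewrite /= addrA. Qed.
Lemma qaddC : commutative qadd.
Proof. by move=> p q; apply: quatP; rewrite /= addrC. Qed.
Lemma qadd0 : left_id (Quat a b 0 0 0 0) qadd.
Proof. by move=> p; apply: quatP; rewrite /= add0r. Qed.
Lemma qaddN : left_inverse (Quat a b 0 0 0 0) qopp qadd.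
Proof. by move=> p; apply: quatP; rewrite /= addNr. Qed.

HB.instance Definition _ := GRing.isZmodule.Build Q qaddA qaddC qadd0 qaddN.

Definition qmul p q : Q :=
  let: Quat p0 p1 p2 p3 := p in let: Quat q0 q1 q2 q3 := q in
  Quat a b
    (p0 * q0 + a * (p1 * q1) + b * (p2 * q2) - a * b * (p3 * q3))
    (p0 * q1 + p1 * q0 + b * (p3 * q2 - p2 * q3))
    (p0 * q2 + p2 * q0 + a * (p1 * q3 - p3 * q1))
    (p0 * q3 + p3 * q0 + p1 * q2 - p2 * q1).

Lemma qmulA : associative qmul.
Proof. by move=> [????] [????] [????]; apply: quatP => /=; ring. Qed.
Lemma qmul1l : left_id (Quat a b 1 0 0 0) qmul.
Proof. by move=> [????]; apply: quatP => /=; ring. Qed.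
Lemma qmul1r : right_id (Quat a b 1 0 0 0) qmul.
Proof. by move=> [????]; apply: quatP => /=; ring. Qed.
Lemma qmulDl : left_distributive qmul qadd.
Proof. by move=> [????] [????] [????]; apply: quatP => /=; ring. Qed.
Lemma qmulDr : right_distributive qmul qadd.
Proof. by move=> [????] [????] [????]; apply: quatP => /=; ring. Qed.
Lemma quat_1neq0 : Quat a b 1 0 0 0 != 0.
Proof. by apply/eqP => -[/eqP]; rewrite oner_eq0. Qed.

HB.instance Definition _ := GRing.Zmodule_isNzRing.Build Q
  qmulA qmul1l qmul1r qmulDl qmulDr quat_1neq0.

Definition qscale (c : K) p : Q :=
  Quat a b (c * qc0 p) (c * qc1 p) (c * qc2 p) (c * qc3 p).

Lemma qscaleA c d p : qscale c (qscale d p) = qscale (c * d) p.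
Proof. by apply: quatP; rewrite /= mulrA. Qed.
Lemma qscale1 : left_id 1 qscale.
Proof. by move=> p; apply: quatP; rewrite /= mul1r. Qed.
Lemma qscaleDr : right_distributive qscale +%R.
Proof. by move=> c p q; apply: quatP; rewrite /= mulrDr. Qed.
Lemma qscaleDl p : {morph qscale^~ p : c d / c + d}.
Proof. by move=> c d; apply: quatP; rewrite /= mulrDl. Qed.

HB.instance Definition _ := GRing.Zmodule_isLmodule.Build K Q
  qscaleA qscale1 qscaleDr qscaleDl.

Lemma qscaleAl (c : K) p q : c *: (p * q) = c *: p * q.
Proof. by case: p q => [????] [????]; apply: quatP => /=; ring. Qed.
Lemma qscaleAr (c : K) p q : c *: (p * q) = p * (c *: q).
Proof. by case: p q => [????] [????]; apply: quatP => /=; ring. Qed.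

HB.instance Definition _ := GRing.Lmodule_isLalgebra.Build K Q qscaleAl.
HB.instance Definition _ := GRing.Lalgebra_isAlgebra.Build K Q qscaleAr.

Definition qx : Q := Quat a b 0 1 0 0.
Definition qy : Q := Quat a b 0 0 1 0.

Lemma qx2 : qx ^+ 2 = a%:A.
Proof. by rewrite expr2; apply: quatP => /=; ring. Qed.
Lemma qy2 : qy ^+ 2 = b%:A.
Proof. by rewrite expr2; apply: quatP => /=; ring. Qed.
Lemma qyx : qy * qx = - (qx * qy).
Proof. by apply: quatP => /=; ring. Qed.
Lemma quatE p : p = (qc0 p)%:A + qc1 p *: qx + qc2 p *: qy + qc3 p *: (qx * qy).
Proof. by case: p => [????]; apply: quatP => /=; ring. Qed.

(* The canonical involution tau. *)
Definition qconj p : Q := Quat a b (qc0 p) (- qc1 p) (- qc2 p) (- qc3 p).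

Lemma qconjD : {morph qconj : p q / p + q}.
Proof. by move=> p q; apply: quatP => //=; rewrite opprD. Qed.
Lemma qconjM p q : qconj (p * q) = qconj q * qconj p.
Proof. by case: p q => [????] [????]; apply: quatP => /=; ring. Qed.
Lemma qconjK : involutive qconj.
Proof. by move=> p; apply: quatP => //=; rewrite opprK. Qed.

Definition Nrd p : K :=
  qc0 p ^+ 2 - a * qc1 p ^+ 2 - b * qc2 p ^+ 2 + a * b * qc3 p ^+ 2.

Lemma NrdE p : (Nrd p)%:A = p * qconj p.
Proof. by case: p => [????]; apply: quatP => /=; rewrite /Nrd /=; ring. Qed.
Lemma NrdE' p : (Nrd p)%:A = qconj p * p.
Proof. by case: p => [????]; apply: quatP => /=; rewrite /Nrd /=; ring. Qed.
Lemma NrdM p q : Nrd (p * q) = Nrd p * Nrd q.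
Proof. by case: p q => [????] [????]; rewrite /Nrd /=; ring. Qed.
Lemma Nrd_conj p : Nrd (qconj p) = Nrd p.
Proof. by case: p => [????]; rewrite /Nrd /=; ring. Qed.
Lemma Nrd1 : Nrd 1 = 1.
Proof. by rewrite /Nrd /=; ring. Qed.
Lemma Nrd_scalar (c : K) : Nrd (c%:A) = c ^+ 2.
Proof. by rewrite /Nrd /=; ring. Qed.

Definition qunit : pred Q := fun p => Nrd p != 0.
Definition qinv p : Q := if qunit p then (Nrd p)^-1 *: qconj p else p.

Lemma qmulVr : {in qunit, left_inverse 1 qinv *%R}.
Proof.
move=> p up; rewrite /qinv (up : qunit p) -scalerAl -NrdE' scalerA mulVf //.
exact: scale1r.
Qed.
Lemma qmulrV : {in qunit, right_inverse 1 qinv *%R}.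
Proof.
move=> p up; rewrite /qinv (up : qunit p) -scalerAr -NrdE scalerA mulVf //.
exact: scale1r.
Qed.
Lemma qunitP p q : q * p = 1 /\ p * q = 1 -> qunit p.
Proof.
move=> [qp _]; apply/eqP => N0; have := Nrd1.
by rewrite -qp NrdM N0 mulr0 => /esym/eqP; rewrite oner_eq0.
Qed.
Lemma qinv_out : {in [predC qunit], qinv =1 id}.
Proof. by move=> p; rewrite inE /qinv => /negPf; rewrite /in_mem /= => ->. Qed.

HB.instance Definition _ := GRing.NzRing_hasMulInverse.Build Q
  qmulVr qmulrV qunitP qinv_out.

Lemma quat_unitE p : (p \is a GRing.unit) = (Nrd p != 0).
Proof. by []. Qed.

End Quaternion.

(* The normalized valuation nu is only meaningful on nonzero elements; *)
(* its value at 0 is irrelevant. *)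
Definition nu_ge (K : fieldType) (nu : K -> int) (n : int) (x : K) :=
  (x == 0) || (n <= nu x).

Record cdvField := CdvField {
  cdv_sort :> fieldType;
  nu : cdv_sort -> int;
  nu_mul : forall x y, x != 0 -> y != 0 -> nu (x * y) = nu x + nu y;
  nu_add : forall x y, x != 0 -> y != 0 -> x + y != 0 ->
    Num.min (nu x) (nu y) <= nu (x + y);
  nu_normalized : exists2 t, t != 0 & nu t = 1;
  nu_complete : forall s : nat -> cdv_sort,
    (forall n : int, exists N : nat, forall i j : nat,
       (N <= i)%N -> (N <= j)%N -> nu_ge nu n (s i - s j)) ->
    exists l : cdv_sort, forall n : int, exists N : nat, forall i : nat,
       (N <= i)%N -> nu_ge nu n (s i - l)
}.
Arguments nu {c}.

Section CdvField.
Variable K : cdvField.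
Implicit Types x y : K.

Definition nuQ x : rat := (nu x)%:~R.

Lemma nuQM x y : x != 0 -> y != 0 -> nuQ (x * y) = nuQ x + nuQ y.
Proof. by move=> x0 y0; rewrite /nuQ nu_mul // intrD. Qed.

Lemma nuQD x y : x != 0 -> y != 0 -> x + y != 0 ->
  Num.min (nuQ x) (nuQ y) <= nuQ (x + y).
Proof.
move=> x0 y0 s0; have := nu_add x0 y0 s0.
by rewrite /nuQ !ge_min !ler_int.
Qed.

Lemma cdv_unit x : x != 0 -> x \is a GRing.unit.
Proof. by rewrite unitfE. Qed.

Definition cdv_val : valDiv := ValDiv cdv_unit nuQM nuQD.

Definition resfield := residue cdv_val.
HB.instance Definition _ := GRing.UnitRing.on resfield.

Lemma resfield_mulC : commutative (@GRing.mul resfield).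
Proof.
move=> e f; rewrite -(liftK e) -(liftK f) -!redM ?lift_O //.
by rewrite [in RHS]mulrC.
Qed.
HB.instance Definition _ :=
  GRing.PzRing_hasCommutativeMul.Build resfield resfield_mulC.
Lemma resfield_field : GRing.field_axiom resfield.
Proof. by move=> e; exact: res_field. Qed.
HB.instance Definition _ := GRing.ComUnitRing_isField.Build resfield resfield_field.

Definition cdv_res (x : K) : resfield := @red cdv_val x.

Definition cdv_unit_elt x := (x != 0) && (nu x == 0).
Definition uniformizer x := (x != 0) && (nu x == 1).

Let nge := @nu_ge K nu.

Lemma nu1 : nu (1 : K) = 0.
Proof.
by apply: (addIr (nu (1 : K))); rewrite add0r -nu_mul ?oner_neq0 ?mulr1.
Qed.

Lemma nge0 n : nge n 0. Proof. by rewrite /nge /nu_ge eqxx. Qed.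

Lemma nuN x : nu (- x) = nu x.
Proof.
have : nuQ (- x) = nuQ x := @valdN cdv_val x.
by move/eqP; rewrite /nuQ eqr_int => /eqP.
Qed.

Lemma nuV x : x != 0 -> nu x^-1 = - nu x.
Proof.
by move=> x0; apply: (addrI (nu x)); rewrite -nu_mul ?invr_eq0 // mulfV // nu1 subrr.
Qed.

Lemma nge_opp n x : nge n (- x) = nge n x.
Proof. by rewrite /nge /nu_ge oppr_eq0 nuN. Qed.

Lemma nge_add n x y : nge n x -> nge n y -> nge n (x + y).
Proof.
rewrite /nge /nu_ge; have [->|x0] := eqVneq x 0; first by rewrite add0r.
have [->|y0] := eqVneq y 0; first by rewrite addr0 (negPf x0).
have [//|s0 /= hx hy] := eqVneq (x + y) 0.
by apply: le_trans (nu_add x0 y0 s0); rewrite le_min hx hy.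
Qed.

Lemma nge_sub n x y : nge n x -> nge n y -> nge n (x - y).
Proof. by move=> hx hy; apply: nge_add; rewrite ?nge_opp. Qed.

Lemma nge_mul m n x y : nge m x -> nge n y -> nge (m + n) (x * y).
Proof.
rewrite /nge /nu_ge; have [->|x0] := eqVneq x 0; first by rewrite mul0r eqxx.
have [->|y0] := eqVneq y 0; first by rewrite mulr0 eqxx.
by move=> /= hx hy; rewrite nu_mul // lerD ?orbT.
Qed.

Lemma nge_le m n x : m <= n -> nge n x -> nge m x.
Proof.
by move=> mn; rewrite /nge /nu_ge => /orP[->//|/(le_trans mn)->]; rewrite orbT.
Qed.

Lemma nge_unit_add x y : nge 1 (x - y) -> cdv_unit_elt x -> cdv_unit_elt y.
Proof.
move=> h /andP[x0 /eqP nx].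
have ge0 z : nu z = 0 -> nge 0 z by rewrite /nge /nu_ge => ->; rewrite lexx orbT.
have y0 : y != 0.
  apply/eqP => y0; move: h; rewrite y0 subr0 /nge /nu_ge nx (negPf x0) /=.
  by [].
rewrite /cdv_unit_elt y0 /=.
have : nge 0 y.
  have -> : y = x - (x - y) by rewrite opprB addrC subrK.
  by apply: nge_sub (ge0 _ nx) _; apply: nge_le h.
rewrite /nge /nu_ge (negPf y0) /= le_eqVlt => /orP[/eqP<-//|hy].
have : nge 1 x.
  have -> : x = y + (x - y) by rewrite addrC subrK.
  by apply: nge_add => //; rewrite /nge /nu_ge (negPf y0) /=; lia.
by rewrite /nge /nu_ge (negPf x0) nx.
Qed.

Lemma nge_all x : (forall n : nat, nge n%:Z x) -> x = 0.
Proof.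
move=> h; apply/eqP; have := h (`|nu x|%N.+1); rewrite /nge /nu_ge.
by case/orP => //; lia.
Qed.

Section Hensel.
Hypothesis two_unit : cdv_unit_elt (2%:R : K).
Variables (a t0 : K).
Hypotheses (ha : cdv_unit_elt a) (ht0 : nge 0 t0) (h0 : nge 1 (t0 ^+ 2 - a)).

Definition newton (n : nat) : K :=
  iter n (fun t => t - (t ^+ 2 - a) / (2%:R * t)) t0.

Lemma newton_inv n :
  cdv_unit_elt (newton n) /\ nge n.+1%:Z (newton n ^+ 2 - a).
Proof.
have [two0 /eqP two1] := andP two_unit.
elim: n => [|n [/andP[t_0 /eqP t_v] IH]].
  split=> //; have /andP[s0 /eqP sv] : cdv_unit_elt (t0 ^+ 2).
    by apply: (nge_unit_add _ ha); rewrite -nge_opp opprB.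
  have t00 : t0 != 0 by apply: contraNneq s0 => ->; rewrite expr0n.
  rewrite /cdv_unit_elt t00 /=; move: sv; rewrite expr2 nu_mul //; lia.
have -> : newton n.+1 = newton n - (newton n ^+ 2 - a) / (2%:R * newton n) by [].
set t := newton n in t_0 t_v IH *.
set e := _ / _.
have he : nge n.+1%:Z e.
  rewrite -[X in nge X]addr0 /e; apply: nge_mul IH _.
  by rewrite /nge /nu_ge nuV ?mulf_neq0 // nu_mul // two1 t_v orbT.
split.
  apply: (@nge_unit_add t); last by rewrite /cdv_unit_elt t_0 t_v eqxx.
  by rewrite opprB addrC subrK; apply: nge_le he; lia.
have -> : (t - e) ^+ 2 - a = e * e by rewrite /e; field; rewrite two0 t_0.
by apply: nge_le (nge_mul he he); lia.
Qed.

Lemma newton_step n : nge n.+1%:Z (newton n.+1 - newton n).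
Proof.
have [two0 /eqP two1] := andP two_unit.
have [/andP[t_0 /eqP t_v] IH] := newton_inv n.
have -> : newton n.+1 = newton n - (newton n ^+ 2 - a) / (2%:R * newton n) by [].
rewrite addrAC subrr add0r nge_opp.
rewrite -[X in nge X]addr0; apply: nge_mul IH _.
by rewrite /nge /nu_ge nuV ?mulf_neq0 // nu_mul // two1 t_v orbT.
Qed.

Lemma newton_cauchy n i : (n <= i)%N -> nge n%:Z (newton i - newton n).
Proof.
elim: i => [|i IH]; first by rewrite leqn0 => /eqP->; rewrite subrr nge0.
rewrite leq_eqVlt => /orP[/eqP->|ni]; first by rewrite subrr nge0.
rewrite -(subrK (newton i) (newton i.+1)) -addrA; apply: nge_add (IH ni).
by apply: nge_le (newton_step i); lia.
Qed.

Lemma hensel_sqrt : exists l, l ^+ 2 = a.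
Proof.
case: (@nu_complete K newton) => [n|l hl].
  exists `|n|%N => i j ni nj.
  have -> : newton i - newton j =
    (newton i - newton `|n|%N) - (newton j - newton `|n|%N) by ring.
  by apply: (@nge_le _ `|n|%N); [lia|apply: nge_sub; exact: newton_cauchy].
exists l; apply/eqP; rewrite -subr_eq0; apply/eqP; apply: nge_all => n.
have [N hN] := hl n; pose i := maxn N n.
have := hN i (leq_maxl _ _); set t := newton i => ht.
have [/andP[_ /eqP tv] hi] := newton_inv i.
have t_ge : nge 0 t by rewrite /nge /nu_ge tv lexx orbT.
have -> : l ^+ 2 - a = (t ^+ 2 - a) - ((t - l) * (2%:R * t - (t - l))) by ring.
have ht' : nge n%:Z (t - l) by [].
apply: nge_sub; first by apply: nge_le hi; lia.
rewrite -[X in nge X]addr0; apply: nge_mul ht' _.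
apply: nge_sub; last by apply: nge_le ht.
rewrite -[X in nge X]addr0; apply: nge_mul => //.
by case/andP: two_unit => _ /eqP e; rewrite /nge /nu_ge e lexx orbT.
Qed.
End Hensel.

End CdvField.

Section QuaternionValuation.
Variable K : cdvField.
Hypothesis hk : 2%N \notin [pchar (resfield K)].
Variables a pi : K.
Hypotheses (ha : cdv_unit_elt a) (hpi : uniformizer pi).
Local Notation Q := (quat a pi).
Hypothesis hD : forall d : Q, d != 0 -> d \is a GRing.unit.

Let nge := nu_ge (@nu K).

Lemma two_unit : cdv_unit_elt (2%:R : K).
Proof.
have in1 : @in_O (cdv_val K) 1 := @in_O1 _.
have e : (2%:R : resfield K) = @red (cdv_val K) (1 + 1).
  by rewrite redD // red1 (natrD _ 1 1).
have in2 : @in_O (cdv_val K) (1 + 1) by exact: in_O_add.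
have : (2%:R : resfield K) != 0 by move: hk; rewrite inE /=.
rewrite e red_eq0 // (natrD _ 1 1) /cdv_unit_elt.
move: in2; rewrite /in_O /in_m /vald /= /nuQ negb_or -leNgt.
case: eqP => //= _; rewrite ler0z lerz0 => h1 h2.
by rewrite eq_le h1 h2.
Qed.

Lemma a_nonsquare (t : K) : t ^+ 2 != a.
Proof.
apply/eqP => ta; pose d : Q := Quat a pi t 1 0 0.
have d0 : d != 0 by apply/eqP => -[_ /eqP]; rewrite oner_eq0.
have := hD d0; rewrite quat_unitE /Nrd /= ta => /eqP; apply.
by ring.
Qed.

Lemma norm_unit (t : K) : nge 0 t -> cdv_unit_elt (t ^+ 2 - a).
Proof.
move=> ht; have /andP[_ /eqP a_v] := ha.
have ge : nge 0 (t ^+ 2 - a).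
  apply: nge_sub; last by rewrite /nge /nu_ge a_v lexx orbT.
  by rewrite expr2; apply: (@nge_mul _ 0 0).
have n0 : t ^+ 2 - a != 0 by rewrite subr_eq0 a_nonsquare.
rewrite /cdv_unit_elt n0 /=; move: (ge); rewrite /nge /nu_ge (negPf n0) /=.
rewrite le_eqVlt => /orP[/eqP<-//|ltv].
have [|l /eqP] := hensel_sqrt two_unit ha ht (_ : nge 1 (t ^+ 2 - a)).
  by rewrite /nge /nu_ge (negPf n0) /=; lia.
by rewrite (negPf (a_nonsquare l)).
Qed.

Lemma norm_val (p q : K) : (p != 0) || (q != 0) ->
  exists m : int, [/\ p ^+ 2 - a * q ^+ 2 != 0,
    nu (p ^+ 2 - a * q ^+ 2) = m + m, nge m p & nge m q].
Proof.
have key (s n : K) : s != 0 -> cdv_unit_elt n ->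
    s ^+ 2 * n != 0 /\ nu (s ^+ 2 * n) = nu s + nu s.
  move=> s0 /andP[n0 /eqP nv]; split; first by rewrite mulf_neq0 // expf_neq0.
  by rewrite expr2 !nu_mul ?mulf_neq0 // nv addr0.
have ngenu (s : K) : nge (nu s) s by rewrite /nge /nu_ge lexx orbT.
move=> pq0; have [q0|q0] := eqVneq q 0.
  move: pq0; rewrite q0 eqxx orbF => p0; exists (nu p).
  rewrite expr0n /= mulr0 subr0 expr2 mulf_neq0 // nu_mul //.
  by split=> //; exact: nge0.
have [qp|] := boolP (nge (nu q) p).
  have ht : nge 0 (p / q).
    by rewrite -(subrr (nu q)); apply: nge_mul => //; rewrite -nuV //; exact: ngenu.
  have -> : p ^+ 2 - a * q ^+ 2 = q ^+ 2 * ((p / q) ^+ 2 - a).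
    by field; rewrite q0.
  have [n0 nv] := key _ _ q0 (norm_unit ht).
  by exists (nu q).
rewrite /nge /nu_ge negb_or -ltNge => /andP[p0 pq].
have hs : nge 1 (q / p).
  by rewrite /nge /nu_ge nu_mul ?invr_eq0 // nuV //; apply/orP; right; lia.
have hu : cdv_unit_elt (1 - a * (q / p) ^+ 2).
  apply: (@nge_unit_add _ 1); last by rewrite /cdv_unit_elt oner_eq0 nu1 eqxx.
  rewrite opprB addrC subrK; apply: (@nge_mul _ 0 1).
    by have /andP[_ /eqP a_v] := ha; rewrite /nge /nu_ge a_v lexx orbT.
  by apply: (@nge_le _ _ (1 + 1)) => //; rewrite expr2; apply: nge_mul.
have -> : p ^+ 2 - a * q ^+ 2 = p ^+ 2 * (1 - a * (q / p) ^+ 2).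
  by field; rewrite p0.
have [n0 nv] := key _ _ p0 hu.
exists (nu p); split=> //; first exact: ngenu.
by rewrite /nge /nu_ge (ltW pq) orbT.
Qed.

(* A lower bound on nu (Nrd d) is a bound on each coordinate. *)
Lemma Nrd_ge (n : int) : exists c c' : int,
  (forall d : Q, nge n (Nrd d) -> [/\ nge c (qc0 d), nge c (qc1 d),
     nge c' (qc2 d) & nge c' (qc3 d)]) /\
  (forall d : Q, [/\ nge c (qc0 d), nge c (qc1 d),
     nge c' (qc2 d) & nge c' (qc3 d)] -> nge n (Nrd d)).
Proof.
have /andP[pi0 /eqP piv] := hpi; have /andP[a0 /eqP av] := ha.
have [c [c' [h1 h2 h3 h4]]] : exists c c' : int,
   [/\ forall m, n <= m + m -> c <= m, forall m, n <= 1 + (m + m) -> c' <= m,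
       n <= c + c & n <= 1 + (c' + c')].
  have := divz_eq n 2; set k := (n %/ 2)%Z.
  have [r|r] : (n %% 2)%Z = 0 \/ (n %% 2)%Z = 1 by lia.
    by rewrite r => nE; exists k, k; split=> *; lia.
  by rewrite r => nE; exists (k + 1), k; split=> *; lia.
exists c, c'; split=> d; last first.
  case=> g0 g1 g2 g3.
  have -> : Nrd d = (qc0 d ^+ 2 - a * qc1 d ^+ 2) -
     pi * (qc2 d ^+ 2 - a * qc3 d ^+ 2) by rewrite /Nrd; ring.
  have N (e : int) (p q : K) : nge e p -> nge e q ->
      nge (e + e) (p ^+ 2 - a * q ^+ 2).
    move=> gp gq; apply: nge_sub; first by rewrite expr2; apply: nge_mul.
    rewrite -[e + e]add0r; apply: nge_mul.
      by rewrite /nge /nu_ge av lexx orbT.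
    by rewrite expr2; apply: nge_mul.
  apply: nge_sub; first by apply: nge_le h3 _; exact: N.
  apply: nge_le h4 _; apply: nge_mul; last exact: N.
  by rewrite /nge /nu_ge piv lexx orbT.
have -> : Nrd d = (qc0 d ^+ 2 - a * qc1 d ^+ 2) -
   pi * (qc2 d ^+ 2 - a * qc3 d ^+ 2) by rewrite /Nrd; ring.
set A := qc0 d ^+ 2 - _; set B := pi * _.
have auxB m : nge m A -> nge m (A - B) -> nge m B.
  by move=> h h'; rewrite -(subKr A B); apply: nge_sub.
have auxA m : nge m (A - B) -> nge m B -> nge m A.
  by move=> h h'; rewrite -(subrK B A); apply: nge_add.
have sep : nge n (A - B) -> A != 0 -> B != 0 -> nu A != nu B ->
    nge n A && nge n B.
  move=> g A0 B0 nAB; have [hA|hA] := boolP (nge n A).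
    exact: auxB.
  have [hB|hB] := boolP (nge n B).
    by case/negP: hA; exact: auxA.
  exfalso; move: hA hB; rewrite /nge /nu_ge !negb_or -!ltNge A0 B0 /=.
  move=> hA hB; have [lt|lt|eq] := ltgtP (nu A) (nu B); last first.
  - by rewrite eq eqxx in nAB.
  - have : nge (nu B + 1) B.
      apply: auxB.
        by rewrite /nge /nu_ge; apply/orP; right; lia.
      by apply: nge_le g; lia.
    by rewrite /nge /nu_ge (negPf B0) /=; lia.
  - have : nge (nu A + 1) A.
      apply: auxA.
        by apply: nge_le g; lia.
      by rewrite /nge /nu_ge; apply/orP; right; lia.
    by rewrite /nge /nu_ge (negPf A0) /=; lia.
have Avals : [\/ A = 0 /\ (qc0 d = 0 /\ qc1 d = 0) |
   exists m : int, [/\ A != 0, nu A = m + m, nge m (qc0 d) & nge m (qc1 d)]].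
  have [/norm_val h|] := boolP ((qc0 d != 0) || (qc1 d != 0)); first by right.
  rewrite negb_or !negbK => /andP[/eqP e0 /eqP e1]; left.
  by rewrite /A e0 e1; split=> //; rewrite expr0n /= mulr0 subr0.
have Bvals : [\/ B = 0 /\ (qc2 d = 0 /\ qc3 d = 0) |
   exists m : int, [/\ B != 0, nu B = 1 + (m + m), nge m (qc2 d) &
                       nge m (qc3 d)]].
  have [/norm_val[m [n0 nv g2 g3]]|] := boolP ((qc2 d != 0) || (qc3 d != 0)).
    by right; exists m; rewrite /B mulf_neq0 // nu_mul // piv nv.
  rewrite negb_or !negbK => /andP[/eqP e0 /eqP e1]; left.
  by rewrite /B e0 e1; split=> //; rewrite expr0n /= mulr0 subr0 mulr0.
move=> g.
have gA : nge n A.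
  case: Avals Bvals => [[-> _] _|[m [A0 nA _ _]] [[B0 _]|[m' [B0 nB _ _]]]].
  - exact: nge0.
  - by move: g; rewrite B0 subr0.
  - have nAB : nu A != nu B by rewrite nA nB; lia.
    by case/andP: (sep g A0 B0 nAB).
have gB : nge n B by exact: auxB.
have [g0 g1] : nge c (qc0 d) /\ nge c (qc1 d).
  case: Avals => [[_ [-> ->]]|[m [A0 nA u v]]]; first by rewrite /nge !nge0.
  move: gA; rewrite /nge /nu_ge (negPf A0) nA /= => /h1 cm.
  by split; apply: nge_le cm _.
have [g2 g3] : nge c' (qc2 d) /\ nge c' (qc3 d).
  case: Bvals => [[_ [-> ->]]|[m [B0 nB u v]]]; first by rewrite /nge !nge0.
  move: gB; rewrite /nge /nu_ge (negPf B0) nB /= => /h2 cm.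
  by split; apply: nge_le cm _.
by split.
Qed.

Lemma Nrd_ge_add n (d e : Q) :
  nge n (Nrd d) -> nge n (Nrd e) -> nge n (Nrd (d + e)).
Proof.
have [c [c' [h1 h2]]] := Nrd_ge n.
move=> /h1[d0 d1 d2 d3] /h1[e0 e1 e2 e3]; apply: h2 => /=.
by split; apply: nge_add.
Qed.

Lemma Nrd_neq0 (d : Q) : d != 0 -> Nrd d != 0.
Proof. by move/hD. Qed.

Definition nuD (d : Q) : rat := (nu (Nrd d))%:~R / 2%:R.

Lemma nuD_mul (d e : Q) : d != 0 -> e != 0 -> nuD (d * e) = nuD d + nuD e.
Proof.
by move=> /Nrd_neq0 d0 /Nrd_neq0 e0; rewrite /nuD NrdM nu_mul // intrD mulrDl.
Qed.

Lemma nuD_add (d e : Q) : d != 0 -> e != 0 -> d + e != 0 ->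
  Num.min (nuD d) (nuD e) <= nuD (d + e).
Proof.
move=> /Nrd_neq0 d0 /Nrd_neq0 e0 /Nrd_neq0 s0; rewrite /nuD.
have T (x y : int) :
    ((x%:~R / 2%:R : rat) <= y%:~R / 2%:R) = (x <= y) by
  rewrite ler_pM2r ?invr_gt0 // ler_int.
rewrite ge_min !T -ge_min.
have := @Nrd_ge_add (Num.min (nu (Nrd d)) (nu (Nrd e))) d e.
rewrite /nge /nu_ge (negPf d0) (negPf e0) (negPf s0) /=; apply.
  by rewrite ge_min lexx.
by rewrite ge_min lexx orbT.
Qed.

Definition quat_val : valDiv := ValDiv hD nuD_mul nuD_add.

Lemma nuD_conj (d : quat_val) : nuD (qconj d) = nuD d.
Proof. by rewrite /nuD Nrd_conj. Qed.

Lemma nuD_scalar (c : K) : c != 0 -> nuD (c%:A) = (nu c)%:~R.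
Proof.
move=> c0; rewrite /nuD Nrd_scalar expr2 nu_mul // intrD mulrDl.
by rewrite -splitr.
Qed.

Lemma scalarA_eq0 (c : K) : ((c%:A : Q) == 0) = (c == 0).
Proof.
apply/eqP/eqP => [[]|->]; last by rewrite scale0r.
by rewrite mulr1.
Qed.

Lemma in_O_scalar (c : K) : @in_O quat_val c%:A = @in_O (cdv_val K) c.
Proof.
rewrite /in_O scalarA_eq0; case: eqP => //= /eqP c0.
by rewrite /vald /= nuD_scalar.
Qed.

Lemma in_m_scalar (c : K) : @in_m quat_val c%:A = @in_m (cdv_val K) c.
Proof.
rewrite /in_m scalarA_eq0; case: eqP => //= /eqP c0.
by rewrite /vald /= nuD_scalar.
Qed.

Lemma quat_res_char : (2%:R : residue quat_val) != 0.
Proof.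
have e : (2%:R : residue quat_val) = @red quat_val (2%:R : K)%:A.
  rewrite (natrD K 1 1) scalerDl scale1r redD; last 2 first.
  - exact: (@in_O1 quat_val).
  - exact: (@in_O1 quat_val).
  by rewrite red1 (natrD _ 1 1).
have /andP[t0 /eqP tv] := two_unit.
have mO : @in_O quat_val (2%:R : K)%:A.
  by rewrite in_O_scalar /in_O /vald /= /nuQ tv lexx orbT.
rewrite e red_eq0 // in_m_scalar /in_m negb_or.
by rewrite /vald /= /nuQ tv ltxx andbT.
Qed.

(* (D, tau) with the valuation nuD. *)
Definition quat_ivd : invValDiv :=
  @InvValDiv quat_val (@qconj K a pi) (@qconjD K a pi) (@qconjM K a pi)
    (@qconjK K a pi) nuD_conj quat_res_char.

(* The embedding of k in the residue division ring induced by K -> D. *)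
Definition k_incl (e : resfield K) : residue quat_val :=
  @red quat_val (res_lift e : K)%:A.

Lemma k_incl_red (c : K) : @in_O (cdv_val K) c ->
  k_incl (cdv_res c) = @red quat_val c%:A.
Proof.
move=> cO; apply/redP; rewrite ?in_O_scalar //; first exact: lift_O.
rewrite -scalerBl in_m_scalar; apply/redP => //; first exact: lift_O.
by rewrite liftK.
Qed.

Lemma k_incl_zmod : zmod_morphism k_incl.
Proof.
move=> e f; rewrite -(liftK e) -(liftK f).
have Oe := lift_O e; have Of := lift_O f.
have ON : @in_O (cdv_val K) (- res_lift f) by rewrite in_O_opp.
rewrite -redN // -redD // !k_incl_red ?in_O_add // scalerDl scaleNr.
by rewrite redD ?redN ?in_O_opp ?in_O_scalar.
Qed.

Lemma k_incl_monoid : monoid_morphism k_incl.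
Proof.
split=> [|e f].
  by rewrite -red1 [LHS]k_incl_red ?in_O1 // scale1r.
rewrite -(liftK e) -(liftK f).
have Oe := lift_O e; have Of := lift_O f.
rewrite -redM // !k_incl_red ?in_O_mul //.
by rewrite -scalerA -[X in _ *: X]mul1r scalerAl redM ?in_O_scalar.
Qed.

HB.instance Definition _ :=
  GRing.isZmodMorphism.Build (resfield K) (residue quat_val) k_incl k_incl_zmod.
HB.instance Definition _ :=
  GRing.isMonoidMorphism.Build (resfield K) (residue quat_val) k_incl
    k_incl_monoid.

Section Scalar.
Variable delta : K.
Hypothesis hdelta : cdv_unit_elt delta.

Lemma scalar_entries :
  @diag_entries (ivdiv quat_ivd) 1 (\row_(i < 1) (delta%:A : Q)).
Proof.
have /andP[d0 _] := hdelta; move=> i; rewrite mxE; split.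
  by apply: quatP; rewrite /= ?mulr0 ?oppr0.
by rewrite [_ == _]scalarA_eq0.
Qed.

Lemma res_scalar_entries :
  @diag_entries (ivres quat_ivd) 1 (\row_(i < 1) k_incl (cdv_res delta)).
Proof.
have /andP[d0 /eqP dv] := hdelta; move=> i; rewrite mxE.
have dO : @in_O (cdv_val K) delta by rewrite /in_O /vald /= /nuQ dv lexx orbT.
rewrite k_incl_red //; split.
  rewrite [LHS](@red_conj quat_ivd) ?in_O_scalar //; congr red.
  by apply: quatP; rewrite /= ?mulr0 ?oppr0.
rewrite red_eq0 ?in_O_scalar // in_m_scalar /in_m negb_or d0.
by rewrite /vald /= /nuQ dv ltxx.
Qed.

Definition scalar_form := diagf scalar_entries.
Definition res_scalar_form := diagf res_scalar_entries.
End Scalar.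

End QuaternionValuation.

(* E is the field k(X), of degree 2 over k by means of i, with X^2 = s, *)
(* and [invol] is its nontrivial k-automorphism (char k is not 2). *)
Definition quadratic_ext (k : fieldType) (E : divInv)
    (i : {rmorphism k -> E}) (X : E) (s : k) : Prop :=
  [/\ commutative (@GRing.mul E),
      forall e : E, exists! c : k * k, e = i c.1 + i c.2 * X,
      X ^+ 2 = i s,
      forall c, invol (i c) = i c &
      invol X = - X].

(* Main.v *)
Require Import Defs.
From HB Require Import structures.
From mathcomp Require Import all_boot all_order all_algebra.
From mathcomp Require Import boolp.
From mathcomp Require Import ring zify.

Set Implicit Arguments.
Unset Strict Implicit.
Unset Printing Implicit Defensive.
Import Order.TTheory GRing.Theory Num.Theory.
Local Open Scope ring_scope.

(** The mechanism is Springer's theorem for forms over a complete discretely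
    valued division algebra, reduced to two properties of (D, tau).

    The symmetric elements of D are the scalars of K. Scaling a diagonal entry c
    by d changes it to tau(d) c d, of valuation nu_D(c) + 2 nu_D(d); as nu_D(y) is
    1/2, every integer is cancelled by some d, so diagonal entries can be made
    units and every form is unramified ([quat_unit_scaling], [all_unramified]).
    Two units of K with the same residue differ by a square of K, by Hensel's
    lemma ([quat_hensel]).

    For an involution with these two properties, reduction of forms with unit
    entries is compatible with Witt classes in both directions. If the reductions
    of u and v are isometric, an integral lift of the isometry carries u to a
    Gram matrix congruent to v, and Gram-Schmidt over the valuation ring together
    with the Hensel property turns the congruence into an isometry
    ([integral_diagonalization], [isometry_lift]). Hence Witt equivalence of
    reductions lifts ([unit_class_of_res]). Conversely, if u has class 0, replace
    its reduction by an anisotropic representative and lift that one to a form w: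
    w is again of class 0, and it is anisotropic because an isotropic vector,
    scaled to be integral and primitive, would reduce to one ([unit_isotropic]).
    By Witt cancellation an anisotropic form of class 0 has dimension 0, so the
    reduction of u has class 0 as well ([res_class0]). The map is therefore
    well-defined and injective; it is surjective since symmetric residues lift to
    symmetric units ([larmour_isomorphism]).

    For the residue algebra, nu_K of p^2 - a q^2 is even, with half of it bounding
    the valuations of p and q. So an element of the valuation ring has integral
    coordinates on 1 and x, its component on y and z lies in the maximal ideal,
    and the residues of 1 and x form a basis over k ([residue_quadratic]). *)

(** * Hermitian forms over a division algebra with involution *)

Section Congruence.
Variable E : divInv.

(** Isometry on bare Gram matrices, so that blocks produced by elimination need no
    proofs of symmetry and nondegeneracy. *)
Definition cong m n (M : 'M[E]_m) (M' : 'M[E]_n) :=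
  exists (P : 'M_(m, n)) (Q : 'M_(n, m)),
    [/\ P *m Q = 1%:M, Q *m P = 1%:M & M' = ctr P *m M *m P].

Definition nondeg n (M : 'M[E]_n) := exists N, M *m N = 1%:M /\ N *m M = 1%:M.

Lemma cong_refl n (M : 'M[E]_n) : cong M M.
Proof. by exists 1%:M, 1%:M; rewrite ctr1 !mulmx1 mul1mx. Qed.

Lemma cong_sym m n (M : 'M[E]_m) (M' : 'M[E]_n) : cong M M' -> cong M' M.
Proof.
move=> [P [Q [PQ QP ->]]]; exists Q, P; split=> //.
by rewrite !mulmxA -ctr_mul PQ ctr1 mul1mx -mulmxA PQ mulmx1.
Qed.

Lemma cong_trans l m n (L : 'M[E]_l) (M : 'M[E]_m) (N : 'M[E]_n) :
  cong L M -> cong M N -> cong L N.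
Proof.
move=> [P [Q [PQ QP e]]] [P' [Q' [PQ' QP' e']]].
exists (P *m P'), (Q' *m Q); split.
- by rewrite -mulmxA (mulmxA P') PQ' mul1mx.
- by rewrite -mulmxA (mulmxA Q) QP mul1mx.
- by rewrite e' e ctr_mul !mulmxA.
Qed.

Lemma cong_block m n m' n' (M1 : 'M[E]_m) (M2 : 'M[E]_n) (N1 : 'M[E]_m')
    (N2 : 'M[E]_n') :
  cong M1 N1 -> cong M2 N2 -> cong (block_mx M1 0 0 M2) (block_mx N1 0 0 N2).
Proof.
move=> [P [Q [PQ QP ->]]] [P' [Q' [PQ' QP' ->]]].
exists (block_mx P 0 0 P'), (block_mx Q 0 0 Q'); split=> /=;
  rewrite ?ctr_block ?ctr0 !mulmx_block !mulmx0 !mul0mx !addr0 !add0r.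
- by rewrite PQ PQ' -scalar_mx_block.
- by rewrite QP QP' -scalar_mx_block.
- by rewrite ?mul0mx ?addr0.
Qed.

Lemma cong_herm m n (M : 'M[E]_m) (N : 'M[E]_n) :
  cong M N -> ctr M = M -> ctr N = N.
Proof. by move=> [P [Q [_ _ ->]]] hM; rewrite !ctr_mul ctrK hM mulmxA. Qed.

Lemma cong_nondeg m n (M : 'M[E]_m) (N : 'M[E]_n) :
  cong M N -> nondeg M -> nondeg N.
Proof.
move=> [P [Q [PQ QP ->]]] [L [ML LM]]; exists (Q *m L *m ctr Q); split.
  rewrite -!mulmxA (mulmxA P) PQ mul1mx (mulmxA M) ML mul1mx -ctr_mul QP.
  exact: ctr1.
rewrite -!mulmxA (mulmxA (ctr Q)) -ctr_mul PQ ctr1 mul1mx (mulmxA L) LM mul1mx.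
exact: QP.
Qed.

Lemma nondeg_drblock m n (M : 'M[E]_m) (N : 'M[E]_n) :
  nondeg (block_mx M 0 0 N) -> nondeg N.
Proof.
move=> [L [ML LM]]; exists (drsubmx L); move: ML LM.
rewrite -[L]submxK !mulmx_block !scalar_mx_block block_mxKdr.
by split; [have [_ _ _] := eq_block_mx ML | have [_ _ _] := eq_block_mx LM];
  rewrite ?mul0mx ?mulmx0 add0r.
Qed.

(** Completing the square. *)
Lemma cong_schur m n (a a' : 'M[E]_m) (b : 'M[E]_(m, n)) (d : 'M[E]_n) :
  ctr a = a -> a *m a' = 1%:M -> a' *m a = 1%:M ->
  cong (block_mx a b (ctr b) d) (block_mx a 0 0 (d - ctr b *m a' *m b)).
Proof.
move=> ha aa' a'a.
have ha' : ctr a' = a'.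
  have e : ctr a' *m a = 1%:M by rewrite -{1}ha -ctr_mul aa' ctr1.
  by rewrite -[ctr a']mulmx1 -aa' mulmxA e mul1mx.
exists (block_mx 1%:M (- (a' *m b)) 0 1%:M), (block_mx 1%:M (a' *m b) 0 1%:M).
split; rewrite ?ctr_block ?ctr0 ?ctr1 ?ctrN ?ctr_mul ?ha' !mulmx_block;
  rewrite !(mulmx0, mul0mx, mulmx1, mul1mx, addr0, add0r).
- by rewrite subrr -scalar_mx_block.
- by rewrite addNr -scalar_mx_block.
- rewrite !(mulNmx, mulmxN) -!mulmxA a'a (mulmxA a) aa' !(mul1mx, mulmx1).
  by rewrite !addNr mul0mx oppr0 add0r addrC.
Qed.

Lemma divInv_mulV (x : E) : x != 0 -> x * x^-1 = 1 /\ x^-1 * x = 1.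
Proof. by move=> /divInv_field ux; rewrite mulrV ?mulVr. Qed.

Lemma scalar1_mul (x y : E) : x%:M *m y%:M = (x * y)%:M :> 'M_1.
Proof. by rewrite -scalar_mxM. Qed.

Lemma ctr_scalar1 (x : E) : ctr (x%:M : 'M_1) = (invol x)%:M.
Proof. by apply/matrixP => i j; rewrite !mxE !ord1 eqxx !mulr1n. Qed.

Lemma mx1_inv (a : 'M[E]_1) : a != 0 -> exists a', a *m a' = 1%:M /\ a' *m a = 1%:M.
Proof.
move=> a0; have [h1 h2] : a 0 0 * (a 0 0)^-1 = 1 /\ (a 0 0)^-1 * a 0 0 = 1.
  apply: divInv_mulV; apply: contraNneq a0 => e.
  by rewrite [a]mx11_scalar e; apply/eqP/matrixP => i j; rewrite !mxE mul0rn.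
by rewrite [a]mx11_scalar; exists ((a 0 0)^-1)%:M; rewrite !scalar1_mul h1 h2.
Qed.

Lemma two_neq0 : (1 + 1 : E) != 0.
Proof. by rewrite -(natrD _ 1 1) divInv_char. Qed.

Lemma row_right_inv n (r : 'rV[E]_n) : r != 0 -> exists w : 'cV_n, r *m w = 1%:M.
Proof.
move=> r0; have [j rj] : exists j, r 0 j != 0.
  apply/existsP; apply: contraNT r0; rewrite negb_exists => /forallP r0.
  apply/eqP/rowP => j; rewrite mxE; apply/eqP; have := r0 j.
  by rewrite negbK.
exists (delta_mx j 0 *m ((r 0 j)^-1)%:M).
rewrite mulmxA -colE [col j r]mx11_scalar mxE scalar1_mul.
by rewrite (divInv_mulV rj).1.
Qed.

(** A vector (a; w) with a nonzero is the first column of a lower triangular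
    matrix; if a vanishes, a transvection by t with t w = 1 makes it nonzero. *)
Lemma basis_extension n (v : 'cV[E]_(1 + n)) : v != 0 ->
  exists P Q : 'M[E]_(1 + n), [/\ P *m Q = 1%:M, Q *m P = 1%:M & lsubmx P = v].
Proof.
have pivot (a : 'M_1) (w : 'cV_n) : a != 0 -> exists P Q : 'M[E]_(1 + n),
    [/\ P *m Q = 1%:M, Q *m P = 1%:M & lsubmx P = col_mx a w].
  move=> /mx1_inv[a' [aa' a'a]].
  exists (block_mx a 0 w 1%:M), (block_mx a' 0 (- (w *m a')) 1%:M).
  split; last by rewrite block_mxEh row_mxKl.
  - rewrite mulmx_block !(mulmx0, mul0mx, mulmx1, mul1mx, addr0, add0r) aa'.
    by rewrite subrr -scalar_mx_block.
  - rewrite mulmx_block !(mulmx0, mul0mx, mulmx1, mul1mx, addr0, add0r) a'a.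
    by rewrite mulNmx -mulmxA a'a mulmx1 addNr -scalar_mx_block.
rewrite -[v]vsubmxK; set a := usubmx v; set w := dsubmx v => v0.
have [a0|/pivot//] := eqVneq a 0.
have w0 : w != 0.
  by apply: contraNneq v0 => w0; rewrite a0 w0 col_mx0.
have [t wt] : exists t : 'rV[E]_n, t *m w = 1%:M.
  have [|t wt] := @row_right_inv n (ctr w).
    by apply: contraNneq w0 => e; rewrite -[w]ctrK e ctr0.
  by exists (ctr t); rewrite -[w]ctrK -ctr_mul wt ctr1.
have [|P [Q [PQ QP lP]]] := pivot 1%:M w; first exact: matrix_nonzero1.
pose T s : 'M[E]_(1 + n) := block_mx 1%:M (s *: t) 0 1%:M.
have TT s : T s *m T (- s) = 1%:M.
  rewrite mulmx_block !(mulmx0, mul0mx, mulmx1, mul1mx, addr0, add0r).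
  by rewrite -scalerDl addNr scale0r -scalar_mx_block.
exists (T (- 1) *m P), (Q *m T 1); split.
- by rewrite -mulmxA (mulmxA P) PQ mul1mx -{2}[1]opprK TT.
- by rewrite -mulmxA (mulmxA (T 1)) TT mul1mx.
rewrite -mulmx_lsub lP mul_block_col scaleN1r mulNmx wt.
by rewrite !mul1mx subrr mul0mx add0r a0.
Qed.

Definition val_at n (M : 'M[E]_n) (v : 'cV[E]_n) := ctr v *m M *m v.

(** Complete v to a basis and take the Schur complement. The second clause allows
    a further vector, orthogonal to v, to be found again in the complement. *)
Lemma split_value n (M : 'M[E]_(1 + n)) (v : 'cV_(1 + n)) :
  ctr M = M -> val_at M v != 0 ->
  exists M1 : 'M[E]_n,
    cong M (block_mx (val_at M v) 0 0 M1) /\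
    forall y, ctr v *m M *m y = 0 -> exists y1, val_at M y = val_at M1 y1.
Proof.
move=> hM c0; have v0 : v != 0.
  by apply: contraNneq c0 => ->; rewrite /val_at mulmx0.
have [P [Q [PQ QP lP]]] := basis_extension v0.
set r := rsubmx P; have eP : P = row_mx v r by rewrite -lP hsubmxK.
have [a' [aa' a'a]] := mx1_inv c0.
have ha : ctr (val_at M v) = val_at M v.
  by rewrite /val_at !ctr_mul ctrK hM mulmxA.
pose b := ctr v *m M *m r; pose d := ctr r *m M *m r.
have eN : ctr P *m M *m P = block_mx (val_at M v) b (ctr b) d.
  rewrite eP /ctr tr_row_mx map_col_mx -!/(ctr _) -mulmxA mul_mx_row.
  by rewrite mul_col_row !mulmxA /b !ctr_mul ctrK hM mulmxA.
exists (d - ctr b *m a' *m b); split.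
  by apply: cong_trans (cong_schur _ _ ha aa' a'a); rewrite -eN; exists P, Q.
move=> y vy; set z := Q *m y; have ey : y = P *m z by rewrite mulmxA PQ mul1mx.
have vz : val_at M v *m usubmx z + b *m dsubmx z = 0.
  rewrite -[RHS]vy ey eP -{3}[z]vsubmxK mul_row_col mulmxDr !mulmxA.
  by [].
have uz : usubmx z = - (a' *m b *m dsubmx z).
  have /eqP := congr1 (mulmx a') vz; rewrite mulmxDr mulmxA a'a mul1mx mulmx0.
  by rewrite addr_eq0 mulmxA => /eqP.
exists (dsubmx z).
have -> : val_at M y = ctr z *m (ctr P *m M *m P) *m z.
  by rewrite /val_at ey ctr_mul !mulmxA.
rewrite eN -{1 2}[z]vsubmxK -mulmxA mul_block_col vz.
rewrite /ctr tr_col_mx map_row_mx -!/(ctr _) mul_row_col mulmx0 add0r.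
rewrite uz.
rewrite mulmxN addrC /val_at.
by rewrite -(mulmxA _ (_ - _)) mulmxBl -!mulmxA.
Qed.

Lemma ctrD m n (M N : 'M[E]_(m, n)) : ctr (M + N) = ctr M + ctr N.
Proof. by apply/matrixP => i j; rewrite !mxE conjD. Qed.

Lemma val_atD n (M : 'M[E]_n) v w : ctr M = M ->
  val_at M (v + w) = val_at M v + val_at M w
    + (ctr v *m M *m w + ctr (ctr v *m M *m w)).
Proof.
move=> hM; rewrite /val_at ctrD !ctr_mul ctrK hM !mulmxDl !mulmxDr !mulmxA.
by rewrite [RHS]addrACA; congr (_ + _); exact: addrC.
Qed.

Lemma val_atM n (M : 'M[E]_n) v (t : 'M_1) :
  val_at M (v *m t) = ctr t *m val_at M v *m t.
Proof. by rewrite /val_at ctr_mul !mulmxA. Qed.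

(** By nondegeneracy the row of pairings with v is nonzero. *)
Lemma dual_vector n (M : 'M[E]_n) (v : 'cV_n) : nondeg M -> v != 0 ->
  exists w, ctr v *m M *m w = 1%:M.
Proof.
move=> [N [MN NM]] v0; apply: row_right_inv; apply: contraNneq v0 => e.
have : ctr v = 0 by rewrite -[ctr v]mulmx1 -MN mulmxA e mul0mx.
by move=> ev; rewrite -[v]ctrK ev ctr0.
Qed.

Definition isotropic n (M : 'M[E]_n) := exists2 v, v != 0 & val_at M v = 0.

(** By polarization: if v and w have norm 0 and pair to 1, then v + w has
    norm 2. *)
Lemma exists_nonzero_value n (M : 'M[E]_(1 + n)) : ctr M = M -> nondeg M ->
  exists v, val_at M v != 0.
Proof.
move=> hM rM; have v0 : (delta_mx 0 0 : 'cV[E]_(1 + n)) != 0.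
  by apply/eqP => /matrixP/(_ 0 0)/eqP; rewrite !mxE !eqxx oner_eq0.
have [w vw] := dual_vector rM v0; set v := delta_mx _ _ in v0 vw.
have [ev|] := eqVneq (val_at M v) 0; last by exists v.
have [ew|] := eqVneq (val_at M w) 0; last by exists w.
exists (v + w); rewrite val_atD // ev ew vw ctr1 !add0r.
apply/eqP => /matrixP/(_ 0 0)/eqP; rewrite !mxE /= !mulr1n.
by rewrite (negPf two_neq0).
Qed.

Lemma diagonalization n (M : 'M[E]_n) : ctr M = M -> nondeg M ->
  exists u : 'rV_n, diag_entries u /\ cong M (diag_mx u).
Proof.
elim: n M => [|n IH] M hM rM.
  exists 0; split; first by case.
  suff -> : M = diag_mx 0 by apply: cong_refl.
  by apply/matrixP => - [].
have [v c0] := exists_nonzero_value hM rM.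
have [M1 [cM _]] := split_value hM c0.
have hB := cong_herm cM hM; have rB := cong_nondeg cM rM.
move: hB; rewrite ctr_block => /eq_block_mx[hc _ _ hM1].
have [u1 [hu1 c1]] := IH M1 hM1 (nondeg_drblock rB).
exists (row_mx (val_at M v) u1 : 'rV_(1 + n)); split; last first.
  have e := diag_mx_row (val_at M v) u1.
  apply: (@cong_trans _ _ _ _ _ (diag_mx (row_mx (val_at M v) u1)) cM).
  rewrite e; apply: cong_block c1.
  suff {1}-> : val_at M v = diag_mx (val_at M v) by apply: cong_refl.
  by apply/matrixP => i j; rewrite !mxE !ord1 eqxx mulr1n.
move=> i; case: (@split_ordP 1 n i) => j ->; rewrite ?(@row_mxEl E 1 1 n) ?(@row_mxEr E 1 1 n) //.
rewrite !ord1; split.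
  by rewrite -{2}hc !mxE.
apply: contraNneq c0 => e; apply/eqP/matrixP => i' j'.
by rewrite !ord1 e mxE.
Qed.

Lemma cong_isotropic m n (M : 'M[E]_m) (N : 'M[E]_n) :
  cong M N -> isotropic M -> isotropic N.
Proof.
move=> [P [Q [PQ QP ->]]] [v v0 vM]; exists (Q *m v).
  by apply: contraNneq v0 => e; rewrite -[v]mul1mx -PQ -mulmxA e mulmx0.
rewrite /val_at ctr_mul !mulmxA -(mulmxA (ctr v)) -ctr_mul PQ ctr1 mulmx1.
by rewrite -(mulmxA _ P) PQ mulmx1.
Qed.

Lemma cong_dim0 m (M : 'M[E]_m) (N : 'M[E]_0) : cong M N -> m = 0%N.
Proof.
move=> [P [Q [PQ _ _]]]; case: m M P Q PQ => // m M P Q /matrixP/(_ 0 0)/eqP.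
by rewrite !mxE big_ord0 eqxx mulr1n eq_sym oner_eq0.
Qed.

(** With X = F B we have (A - 1) X = B, so the isometry maps (-X; 1) to
    (-X; D - C X); in the comparison of norms the contribution of -X cancels. *)
Lemma cancel_norm m n p (u : 'M[E]_m) (M : 'M[E]_n) (N : 'M[E]_p)
    (A : 'M[E]_m) B C D F :
  (A - 1%:M) *m F = 1%:M ->
  block_mx u 0 0 N = ctr (block_mx A B C D) *m block_mx u 0 0 M *m block_mx A B C D ->
  N = ctr (D - C *m F *m B) *m M *m (D - C *m F *m B).
Proof.
move=> AF e; have [X eX] : exists X, X = F *m B by exists (F *m B).
pose z := col_mx (- X) 1%:M : 'M[E]_(m + p, p).
have Pz : block_mx A B C D *m z = col_mx (- X) (D - C *m X).
  rewrite mul_block_col !mulmx1 !mulmxN; congr col_mx; last by rewrite addrC.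
  have -> : B = (A - 1%:M) *m X by rewrite eX mulmxA AF mul1mx.
  by rewrite mulmxBl mul1mx addrA addNr add0r.
have norm q (R : 'M[E]_q) (Y : 'M_(q, p)) :
    ctr (col_mx (- X) Y) *m block_mx u 0 0 R *m col_mx (- X) Y =
    ctr X *m u *m X + ctr Y *m R *m Y.
  rewrite /ctr tr_col_mx map_row_mx -!/(ctr _) mul_row_block !mulmx0 addr0 add0r.
  by rewrite mul_row_col ctrN mulNmx mulNmx mulmxN opprK.
have := norm _ N 1%:M; rewrite e -/z !mulmxA -ctr_mul -(mulmxA _ _ z) Pz.
rewrite norm ctr1 mul1mx mulmx1 -[C *m F *m B]mulmxA -eX => /addrI.
exact: esym.
Qed.

Lemma block_inv m n (a a' : 'M[E]_m) (b b' : 'M[E]_n) :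
  a *m a' = 1%:M -> b *m b' = 1%:M ->
  block_mx a 0 0 b *m block_mx a' 0 0 b' = 1%:M.
Proof.
move=> aa' bb'; rewrite mulmx_block !mulmx0 !mul0mx !addr0 !add0r aa' bb'.
by rewrite -scalar_mx_block.
Qed.

(** If the upper left entry of the isometry is 1, a sign change of the line makes
    it -1; so that entry minus 1 is invertible in one of the two cases. *)
Lemma cancel_line n p (a : 'M[E]_1) (M : 'M[E]_n) (N : 'M[E]_p) :
  a != 0 -> nondeg M -> nondeg N ->
  cong (block_mx a 0 0 M) (block_mx a 0 0 N) -> cong M N.
Proof.
move=> /mx1_inv[a' [aa' a'a]] [M' [MM' M'M]] [N' [NN' N'N]].
have key (P : 'M[E]_(1 + n, 1 + p)) Q : P *m Q = 1%:M -> Q *m P = 1%:M ->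
    block_mx a 0 0 N = ctr P *m block_mx a 0 0 M *m P -> ulsubmx P != 1%:M ->
    cong M N.
  move=> PQ QP e; rewrite -subr_eq0 => /mx1_inv[F [AF FA]].
  (* The dual isometry between the inverse forms: the same computation for it
     inverts the block obtained below from the other side. *)
  have e' : block_mx a' 0 0 M' = P *m block_mx a' 0 0 N' *m ctr P.
    have h : P *m block_mx a' 0 0 N' *m ctr P *m block_mx a 0 0 M = 1%:M.
      rewrite -[LHS]mulmx1 -PQ !mulmxA -(mulmxA _ (block_mx a 0 0 M)).
      rewrite -(mulmxA _ (ctr P)) (mulmxA (ctr P)) -e -(mulmxA P).
      by rewrite block_inv // mulmx1.
    rewrite -[RHS]mulmx1 -(block_inv aa' MM') mulmxA h mul1mx.
    by [].
  move: e e' AF FA; rewrite -[P]submxK; set A := ulsubmx P.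
  rewrite block_mxKul.
  set B := ursubmx P; set C := dlsubmx P; set D := drsubmx P => e e' AF FA.
  have eN := cancel_norm AF e.
  have AF' : (ctr A - 1%:M) *m ctr F = 1%:M.
    by rewrite -[1%:M in X in X *m _]ctr1 -ctrN -ctrD -ctr_mul FA ctr1.
  rewrite ctr_block in e'; rewrite -(ctrK (block_mx A B C D)) ctr_block in e'.
  have := cancel_norm AF' e'.
  have -> : ctr D - ctr B *m ctr F *m ctr C = ctr (D - C *m F *m B).
    by rewrite ctrD ctrN !ctr_mul mulmxA.
  move: (_ - _) eN => R eN; rewrite ctrK => eM.
  exists R, (N' *m ctr R *m M); split=> //.
    by rewrite !mulmxA -eM M'M.
  by rewrite -!mulmxA (mulmxA (ctr R)) -eN N'N.
move=> [P [Q [PQ QP e]]]; have [A1|] := eqVneq (ulsubmx P) 1%:M; last exact: (key P Q).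
pose S k : 'M[E]_(1 + k) := block_mx (- 1%:M) 0 0 1%:M.
have SS k : S k *m S k = 1%:M.
  by apply: block_inv; rewrite ?mulNmx ?mulmxN ?opprK mulmx1.
apply: (key (P *m S p) (S p *m Q)).
- by rewrite -mulmxA (mulmxA (S p)) SS mul1mx.
- by rewrite -mulmxA (mulmxA Q) QP mul1mx.
- have -> : block_mx a 0 0 N = ctr (S p) *m block_mx a 0 0 N *m S p.
    rewrite ctr_block !ctr0 ctrN !ctr1 !mulmx_block.
    rewrite !(mulmx0, mul0mx, mulmx1, mul1mx, addr0, add0r).
    by rewrite !(mulNmx, mulmxN, mul1mx, mulmx1) opprK.
  by rewrite e ctr_mul !mulmxA.
rewrite -[P]submxK mulmx_block block_mxKul A1 mulmx0 addr0 mulmxN mulmx1.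
apply/eqP => /matrixP/(_ 0 0)/eqP; rewrite !mxE /= !mulr1n eq_sym -addr_eq0.
by rewrite (negPf two_neq0).
Qed.

End Congruence.

(** * Witt cancellation and anisotropic representatives *)

Section WittTheory.
Variable E : divInv.
Implicit Types h : hform E.

Lemma form_split n (M : 'M[E]_(1 + n)) hM rM v : val_at M v != 0 ->
  exists M1 hM1 rM1 ha ra, isometric (@HForm E (1 + n) M hM rM)
    (osum (@HForm E 1 (val_at M v) ha ra) (@HForm E n M1 hM1 rM1)) /\
  forall y, ctr v *m M *m y = 0 -> exists y1, val_at M y = val_at M1 y1.
Proof.
move=> c0; have [M1 [cM h1]] := split_value hM c0.
have := cong_herm cM hM; have rB := cong_nondeg cM rM.
rewrite ctr_block => /eq_block_mx[ha _ _ hM1].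
have [a' [aa' a'a]] := mx1_inv c0.
have ra : nondeg (val_at M v) by exists a'.
by exists M1, hM1, (nondeg_drblock rB), ha, ra.
Qed.

(** Lines are split off g and cancelled one at a time. *)
Theorem witt_cancellation g h h' :
  isometric (osum g h) (osum g h') -> isometric h h'.
Proof.
case: g => n M hM rM; elim: n M hM rM h h' => [|n IH] M hM rM h h'.
  have T k : isometric (osum (HForm hM rM) k) k.
    exists (col_mx 0 1%:M), (row_mx 0 1%:M); split=> /=.
    - by rewrite mul_col_row [RHS]scalar_mx_block !mulmx0 !mul0mx mulmx1; congr block_mx; apply/matrixP => - [].
    - by rewrite mul_row_col mul0mx mulmx1 add0r.
    - rewrite /ctr tr_col_mx map_row_mx -!/(ctr _) ctr1 ctr0.
      by rewrite mul_row_block mul_row_col !(mul1mx, mulmx0, mul0mx, addr0, add0r, mulmx1).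
  move=> e; exact: isom_trans (isom_sym (T h)) (isom_trans e (T h')).
have [v c0] := exists_nonzero_value hM rM.
have [M1 [hM1 [rM1 [ha [ra [e1 _]]]]]] := form_split hM rM c0.
move=> e; apply: (IH M1 hM1 rM1).
set c := HForm ha ra in e1; set g := HForm hM1 rM1 in e1 *.
have T k : isometric (osum (HForm hM rM) k) (osum c (osum g k)).
  apply: isom_trans (isom_osum e1 (isom_refl k)) _.
  exact: isom_sym (isom_osumA _ _ _).
apply: (cancel_line c0).
- exact: (gram_nondeg (osum g h)).
- exact: (gram_nondeg (osum g h')).
- exact: isom_trans (isom_sym (T h)) (isom_trans e (T h')).
Qed.

(** An isotropic vector v with partner w gives the orthogonal vectors
    v t + w and v s + w of norms 1 and -1, which split off a form of class 0. *)
Lemma isotropic_reduction h : isotropic (gram h) ->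
  exists h', (dimf h' < dimf h)%N /\ witt_class h = witt_class h'.
Proof.
case: h => -[|n] M hM rM /= [v v0 vM].
  by case/eqP: v0; apply/matrixP => - [].
have [w vw] := dual_vector rM v0; set q := val_at M w.
have hq : ctr q = q by rewrite /q /val_at !ctr_mul ctrK hM mulmxA.
have wv : ctr w *m M *m v = 1%:M by rewrite -ctr1 -vw !ctr_mul ctrK hM mulmxA.
have pair (t s : 'M_1) :
    ctr (v *m t + w) *m M *m (v *m s + w) = ctr t + s + q.
  have {}vM : ctr v *m M *m v = 0 := vM.
  rewrite ctrD ctr_mul !mulmxDl !mulmxDr !mulmxA -!(mulmxA (ctr t)).
  by rewrite vM wv vw mul0mx mulmx0 add0r mulmx1 mul1mx addrA.
pose c2 : E := (2%:R)^-1.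
have half k (A : 'M[E]_k) : c2 *: A + c2 *: A = A.
  by rewrite -scalerDl half2 scale1r.
(* v t + w has norm t + t + q, which is e for t = (e - q) / 2. *)
pose t e : 'M[E]_1 := c2 *: (e%:M - q).
have ht e : invol e = e -> ctr (t e) = t e.
  by move=> he; rewrite ctr_half ctrD ctrN hq ctr_scalar1 he.
have pairt e f : invol e = e ->
    ctr (v *m t e + w) *m M *m (v *m t f + w) = c2 *: (e + f)%:M.
  move=> he; rewrite pair ht // -scalerDr addrACA -raddfD -opprD scalerDr.
  by rewrite scalerN scalerDr half subrK.
pose x := v *m t 1 + w; pose y := v *m t (- 1) + w.
have x1 : val_at M x = 1%:M.
  by rewrite /val_at pairt ?conj1 // scale_scalar_mx mulrDr mulr1 half2.
have y1 : val_at M y = - 1%:M.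
  rewrite /val_at pairt ?conjN ?conj1 // scale_scalar_mx mulrDr mulrN1.
  by rewrite -opprD half2 raddfN.
have xy : ctr x *m M *m y = 0 by rewrite pairt ?conj1 // subrr raddf0 scaler0.
have x0 : val_at M x != 0 by rewrite x1 matrix_nonzero1.
have [M1 [hM1 [rM1 [ha [ra [e1 orth]]]]]] := form_split hM rM x0.
have [z ez] := orth _ xy.
have z0 : val_at M1 z != 0 by rewrite -ez y1 oppr_eq0 matrix_nonzero1.
case: n => [|n] in M hM rM v w v0 vM vw q hq wv pair t ht pairt x y x1 y1 xy
  x0 M1 hM1 rM1 ha ra e1 orth z ez z0 *.
  by case/eqP: z0; rewrite /val_at [M1]flatmx0 mulmx0 mul0mx.
have [M2 [hM2 [rM2 [hb [rb [e2 _]]]]]] := form_split hM1 rM1 z0.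
exists (HForm hM2 rM2); split; first by rewrite /= -addn2 addnC.
pose c : hform E := HForm ha ra; pose d : hform E := HForm hb rb.
pose h : hform E := HForm hM rM; pose h1 : hform E := HForm hM1 rM1.
pose h2 : hform E := HForm hM2 rM2; rewrite -/h -/h2.
have E1 : witt_class h = witt_class c + witt_class h1.
  by rewrite -witt_classD; exact/witt_classP/isom_witt.
have E2 : witt_class h1 = witt_class d + witt_class h2.
  by rewrite -witt_classD; exact/witt_classP/isom_witt.
have E3 : witt_class c + witt_class d = 0.
  rewrite -witt_classD; transitivity (witt_class (osum c (Defs.oppf c))).
    apply/witt_classP/isom_witt; rewrite /isometric /=.
    by rewrite -ez y1 x1; apply: cong_refl.
  exact/witt_classP/witt_osumN.
by rewrite E1 E2 addrA E3 add0r.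
Qed.

Lemma aniso_representative h :
  exists h', ~ isotropic (gram h') /\ witt_class h = witt_class h'.
Proof.
have [m] := ubnP (dimf h); elim: m h => // m IH h lt_m.
have [/isotropic_reduction[h1 [lt1 e1]]|] := EM (isotropic (gram h)); last by exists h.
have [|h2 [a2 e2]] := IH h1; first exact: leq_trans lt1 lt_m.
by exists h2; rewrite e1.
Qed.

Lemma hyp_isotropic n : isotropic (gram (hyp E n.+1)).
Proof.
exists (col_mx (delta_mx 0 0) 0).
  rewrite col_mx_eq0 negb_and; apply/orP; left.
  by apply/eqP => /matrixP/(_ 0 0)/eqP; rewrite !mxE !eqxx oner_eq0.
rewrite /val_at /= -mulmxA mul_block_col mulmx0 mul0mx addr0 mulmx0 addr0.
rewrite /ctr tr_col_mx map_row_mx -!/(ctr _) mul1mx mul_row_col.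
by rewrite ctr0 mulmx0 mul0mx addr0.
Qed.

(** By cancellation an anisotropic form of class 0 is a hyperbolic form, and
    only the empty hyperbolic form is anisotropic. *)
Lemma aniso_class0 h : ~ isotropic (gram h) -> witt_class h = 0 -> dimf h = 0%N.
Proof.
move=> ah /witt_classP[m [n e]].
have {}e : isometric (osum (hyp E m) h) (hyp E n).
  apply: isom_trans (isom_osumC _ _) _; apply: isom_trans e _.
  by apply: isom_trans (isom_osumC _ _) _; exact: hyp0l.
have [mn|nm] := leqP m n.
  move: e; rewrite -(subnKC mn) => e.
  have {}e := witt_cancellation (isom_trans e (isom_hypD _ _ _)).
  case: (n - m)%N e => [|k] e; first exact: cong_dim0 e.
  by case: ah; exact: cong_isotropic (isom_sym e) (hyp_isotropic k).
move: e; rewrite -(subnKC (ltnW nm)) => e.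
have {}e : isometric (osum (hyp E n) (osum (hyp E (m - n)) h)) (osum (hyp E n) (hyp E 0)).
  apply: isom_trans (isom_osumA _ _ _) _.
  apply: isom_trans (isom_osum (isom_sym (isom_hypD _ _ _)) (isom_refl h)) _.
  exact: isom_trans e (isom_sym (hyp0l _)).
have /eqP := cong_dim0 (witt_cancellation e).
by rewrite addn_eq0 => /andP[_ /eqP].
Qed.

Lemma dim0_class h : dimf h = 0%N -> witt_class h = 0.
Proof.
case: h => n M hM rM /= n0; move: M hM rM; rewrite n0 => M hM rM.
by apply/witt_classP/isom_witt; exists 0, 0; split; apply/matrixP => - [].
Qed.

End WittTheory.

(** * Reduction of integral matrices *)

Section IntegralMatrices.
Variable D : invValDiv.
Local Notation E := (ivdiv D).
Local Notation B := (ivres D).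

Definition intmx m n (A : 'M[E]_(m, n)) := forall i j, @in_O D (A i j).

Definition redmx m n (A : 'M[E]_(m, n)) : 'M[B]_(m, n) := map_mx (@red D) A.

Lemma in_O_sum I (r : seq I) (F : I -> D) :
  (forall i, in_O (F i)) -> in_O (\sum_(i <- r) F i).
Proof.
move=> FO; elim: r => [|i r IH]; first by rewrite big_nil in_O0.
by rewrite big_cons in_O_add.
Qed.

Lemma red_sum I (r : seq I) (F : I -> D) :
  (forall i, in_O (F i)) -> red (\sum_(i <- r) F i) = \sum_(i <- r) red (F i).
Proof.
move=> FO; elim: r => [|i r IH]; first by rewrite !big_nil red0.
by rewrite !big_cons redD ?in_O_sum // IH.
Qed.

Lemma intmx_mul m n p (A : 'M[E]_(m, n)) (C : 'M_(n, p)) :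
  intmx A -> intmx C -> intmx (A *m C).
Proof. by move=> iA iC i j; rewrite mxE in_O_sum // => k; exact: in_O_mul. Qed.

Lemma redmx_mul m n p (A : 'M[E]_(m, n)) (C : 'M_(n, p)) :
  intmx A -> intmx C -> redmx (A *m C) = redmx A *m redmx C.
Proof.
move=> iA iC; apply/matrixP => i j; rewrite !mxE red_sum => [|k].
  by apply: eq_bigr => k _; rewrite !mxE redM.
exact: in_O_mul.
Qed.

Lemma intmx_ctr m n (A : 'M[E]_(m, n)) : intmx A -> intmx (ctr A).
Proof. by move=> iA i j; rewrite !mxE [in_O _]in_O_conj. Qed.

Lemma redmx_ctr m n (A : 'M[E]_(m, n)) : intmx A -> redmx (ctr A) = ctr (redmx A).
Proof. by move=> iA; apply/matrixP => i j; rewrite !mxE [RHS]red_conj. Qed.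

Lemma intmx_sub m n (A C : 'M[E]_(m, n)) : intmx A -> intmx C -> intmx (A - C).
Proof. by move=> iA iC i j; rewrite !mxE; apply: in_O_add; rewrite ?in_O_opp. Qed.

Lemma redmx_sub m n (A C : 'M[E]_(m, n)) :
  intmx A -> intmx C -> redmx (A - C) = redmx A - redmx C.
Proof.
move=> iA iC; apply/matrixP => i j.
by rewrite !mxE redD ?redN ?in_O_opp.
Qed.

Lemma redmx_diag n (u : 'rV[E]_n) : redmx (diag_mx u) = diag_mx (redmx u).
Proof.
by apply/matrixP => i j; rewrite !mxE; case: (i == j); rewrite ?mulr1n ?mulr0n ?red0.
Qed.

Lemma intmx_diag n (u : 'rV[E]_n) : intmx u -> intmx (diag_mx u).
Proof.
by move=> iu i j; rewrite !mxE; case: (i == j); rewrite ?mulr1n ?mulr0n ?in_O0.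
Qed.

Definition liftmx m n (A : 'M[B]_(m, n)) : 'M[E]_(m, n) := map_mx (@res_lift D) A.

Lemma liftmx_int m n (A : 'M[B]_(m, n)) : intmx (liftmx A).
Proof. by move=> i j; rewrite mxE lift_O. Qed.

Lemma liftmxK m n (A : 'M[B]_(m, n)) : redmx (liftmx A) = A.
Proof. by apply/matrixP => i j; rewrite !mxE Defs.liftK. Qed.

Lemma unit_entries_int n (u : 'rV[D]_n) : unit_entries u -> intmx u.
Proof. by move=> hu i j; rewrite ord1; case: (hu j) => _ _ e; rewrite /in_O e lexx orbT. Qed.

End IntegralMatrices.

Lemma witt_classB (F : divInv) (h h' : hform F) :
  witt_class (osum h (Defs.oppf h')) = witt_class h - witt_class h'.
Proof. by rewrite witt_classD; congr (_ + _); rewrite -witt_negE. Qed.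

(** * Larmour's isomorphism *)

Section Larmour.
Variable D : invValDiv.
Local Notation E := (ivdiv D).
Local Notation B := (ivres D).

Definition sym_unit (c : D) := [/\ ivconj c = c, c != 0 & vald c = 0].

(* The two properties of D on which the isomorphism rests: congruent symmetric
   units are equivalent, and symmetric elements can be scaled to units. *)
Hypothesis hensel : forall c v : D, sym_unit c -> sym_unit v ->
  red c = red v -> exists d, ivconj d * c * d = v.
Hypothesis unit_scaling : forall c : D, ivconj c = c -> c != 0 ->
  exists2 d, d != 0 & vald (ivconj d * c * d) = 0.

Lemma sym_unit_red (c : D) : sym_unit c -> in_O c /\ red c != 0.
Proof.
move=> [_ c0 cv]; have cO : in_O c by rewrite /in_O cv lexx orbT.
by rewrite red_eq0 // /in_m negb_or c0 cv ltxx.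
Qed.

Lemma red_sym_unit (c : D) : ivconj c = c -> in_O c -> red c != 0 -> sym_unit c.
Proof.
move=> hc cO; rewrite red_eq0 // /in_m negb_or => /andP[c0 cv].
split=> //; apply/eqP; rewrite eq_le leNgt cv /=.
by move: cO; rewrite /in_O (negPf c0).
Qed.

Lemma cong_scale (c v d : E) : v != 0 -> invol d * c * d = v ->
  cong (c%:M : 'M_1) (v%:M : 'M_1).
Proof.
move=> v0 e; have d0 : d != 0 by apply: contraNneq v0 => d0; rewrite -e d0 mulr0.
have [h1 h2] := divInv_mulV d0.
exists d%:M, (d^-1)%:M; rewrite !scalar1_mul h1 h2; split=> //.
by rewrite ctr_scalar1 !scalar1_mul e.
Qed.

(** Gram-Schmidt over the valuation ring: since the off-diagonal entries lie in the
    maximal ideal, each elimination step preserves the reduction, so the pivots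
    stay units congruent to the entries of v. *)
Lemma integral_diagonalization n (N : 'M[E]_n) (v : 'rV[E]_n) :
  @unit_entries D n v -> ctr N = N -> intmx N ->
  redmx N = diag_mx (redmx v) -> cong N (diag_mx v).
Proof.
elim: n N v => [|n IH] N v hv hN iN e.
  suff -> : N = diag_mx v by apply: cong_refl.
  by apply/matrixP => - [].
move: N v hv hN iN e; rewrite -[n.+1]/(1 + n)%N => N v.
rewrite -[N]submxK -[v]hsubmxK.
move: (ulsubmx N) (ursubmx N) (dlsubmx N) (drsubmx N) (lsubmx v) (rsubmx v).
move=> {N v} a b b' d v0 v1 hv; rewrite ctr_block => /eq_block_mx[ha hb _ hd] iN.
have hv0 : sym_unit (v0 0 0) by have := hv (lshift n 0); rewrite row_mxEl.
have hv1 : @unit_entries D n v1.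
  by move=> i; have := hv (rshift 1 i); rewrite row_mxEr.
rewrite /redmx map_block_mx map_row_mx diag_mx_row => /eq_block_mx[ea eb _ ed].
have eb' : b' = ctr b by rewrite -hb ctrK.
have [ia ib id] : [/\ intmx a, intmx b & intmx d].
  split=> i j.
  - by have := iN (lshift n i) (lshift n j); rewrite block_mxEul.
  - by have := iN (lshift n i) (rshift 1 j); rewrite block_mxEur.
  - by have := iN (rshift 1 i) (rshift 1 j); rewrite block_mxEdr.
have ra : red (a 0 0 : D) = red (v0 0 0 : D).
  by move/matrixP/(_ 0 0): ea; rewrite !mxE mulr1n.
have ua : sym_unit (a 0 0).
  apply: red_sym_unit (ia 0 0) _; first by move/matrixP/(_ 0 0): ha; rewrite !mxE.
  by rewrite ra; have [] := sym_unit_red hv0.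
have [a_sym a0 av] := ua.
have [aa' a'a] := divInv_mulV (a0 : (a 0 0 : E) != 0).
have ea1 : a = (a 0 0)%:M by exact: mx11_scalar.
pose a' : 'M[E]_1 := ((a 0 0)^-1)%:M.
have ia' : intmx a'.
  by move=> i j; rewrite !mxE !ord1 mulr1n /in_O valdV // av oppr0 lexx orbT.
have c1 : cong (block_mx a b b' d) (block_mx a 0 0 (d - ctr b *m a' *m b)).
  by rewrite eb'; apply: cong_schur; rewrite // ea1 scalar1_mul ?aa' ?a'a.
have [_ v00 _] := hv0; have := cong_herm c1.
rewrite !ctr_block => /(_ _)/eq_block_mx[].
  by rewrite ha hb hd -eb'.
move=> _ _ _ hd1; apply: (cong_trans c1); rewrite diag_mx_row; apply: cong_block.
  have [f ef] := hensel ua hv0 ra.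
  have -> : diag_mx v0 = (v0 0 0)%:M.
    by apply/matrixP => i j; rewrite !mxE !ord1 eqxx.
  by rewrite ea1; apply: (cong_scale (d := f)).
apply: IH => //.
- by apply: intmx_sub => //; do !apply: intmx_mul => //; apply: intmx_ctr.
rewrite redmx_sub //; last by do !apply: intmx_mul => //; apply: intmx_ctr.
rewrite redmx_mul //; last by do !apply: intmx_mul => //; apply: intmx_ctr.
by rewrite [redmx b]eb mulmx0 subr0.
Qed.


Lemma sym_unit_inv (c : D) : sym_unit c -> sym_unit c^-1.
Proof.
move=> [hc c0 cv]; split; rewrite ?invr_eq0 ?valdV ?cv ?oppr0 //.
have uc := valDiv_field c0.
by apply: (mulIr uc); rewrite mulVr // -{2}hc -ivconjM mulrV // [LHS](@conj1 E).
Qed.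

Lemma unit_diag_inv n (u : 'rV[E]_n) : @unit_entries D n u ->
  exists2 w : 'rV[E]_n, @unit_entries D n w &
    [/\ diag_mx u *m diag_mx w = 1%:M, diag_mx w *m diag_mx u = 1%:M &
      diag_mx (redmx u) *m diag_mx (redmx w) = 1%:M].
Proof.
move=> hu; exists (\row_i (u 0 i)^-1).
  by move=> i; rewrite mxE; exact: sym_unit_inv (hu i).
have [h1 h2] : diag_mx u *m diag_mx (\row_i (u 0 i)^-1) = 1%:M /\
    diag_mx (\row_i (u 0 i)^-1) *m diag_mx u = 1%:M.
  rewrite !mulmx_diag; split; apply/matrixP => i j; rewrite !mxE;
    have [_ n0 _] := hu i; have [e1 e2] := divInv_mulV (n0 : (u 0 i : E) != 0);
    by case: (i == j); rewrite ?mulr1n ?e1 ?e2.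
split=> //; rewrite -!redmx_diag -redmx_mul ?h1.
- by apply/matrixP => i j; rewrite !mxE; case: (i == j); rewrite ?red0.
- exact/intmx_diag/unit_entries_int.
- apply/intmx_diag/unit_entries_int => i; rewrite mxE; exact: sym_unit_inv (hu i).
Qed.

(** An integral lift P of the isometry carries u to a Gram matrix congruent to v,
    and thus isometric to it. This also makes P injective. For surjectivity, let
    Q lift the inverse isometry: P Q carries the inverse of u to a symmetric matrix
    congruent to it, hence nondegenerate, so P has a right inverse. *)
Lemma isometry_lift m n (u : 'rV[E]_m) (v : 'rV[E]_n)
    (hu : @unit_entries D m u) (hv : @unit_entries D n v) :
  isometric (res_diagf hu) (res_diagf hv) ->
  isometric (unit_diagf hu) (unit_diagf hv).
Proof.
move=> [/= Pb [Qb [PQ QP e]]].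
pose P := liftmx Pb; pose Q := liftmx Qb.
have iP : intmx P := liftmx_int Pb; have iQ : intmx Q := liftmx_int Qb.
have iu := intmx_diag (unit_entries_int hu).
have [w hw [uw wu ruw]] := unit_diag_inv hu.
have iw := intmx_diag (unit_entries_int hw).
have herm_diag k (x : 'rV[E]_k) : @unit_entries D k x -> ctr (diag_mx x) = diag_mx x.
  by move=> hx; exact: (diag_herm (unit_diag hx)).
have c1 : cong (ctr P *m diag_mx u *m P) (diag_mx v).
  apply: integral_diagonalization => //.
  - by rewrite !ctr_mul ctrK herm_diag // mulmxA.
  - by do !apply: intmx_mul => //; apply: intmx_ctr.
  - rewrite !redmx_mul ?redmx_ctr ?liftmxK ?redmx_diag //.
      exact: intmx_ctr.
    by apply: intmx_mul => //; exact: intmx_ctr.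
have c2 : cong (P *m Q *m diag_mx w *m ctr (P *m Q)) (diag_mx w).
  have iPQ : intmx (P *m Q) by exact: intmx_mul.
  apply: integral_diagonalization => //.
  - by rewrite ctr_mul ctrK [ctr (_ *m diag_mx w)]ctr_mul herm_diag // mulmxA.
  - by do !apply: intmx_mul => //; apply: intmx_ctr.
  - rewrite !redmx_mul ?redmx_ctr ?redmx_diag ?redmx_mul ?liftmxK // ?PQ.
      by rewrite ctr1 mulmx1 mul1mx.
    + exact: intmx_mul.
    + exact: intmx_ctr.
have [R PR] : exists R, P *m R = 1%:M.
  have [|L [h _]] := cong_nondeg (cong_sym c2); first by exists (diag_mx u).
  by exists (Q *m diag_mx w *m ctr (P *m Q) *m L); rewrite !mulmxA.
have [|L [_ LN]] := cong_nondeg (cong_sym c1).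
  by have [w' _ [h1 h2 _]] := unit_diag_inv hv; exists (diag_mx w').
apply: cong_trans c1; exists P, R; split=> //.
have LP : L *m ctr P *m diag_mx u *m P = 1%:M by rewrite -LN !mulmxA.
by rewrite -[R]mul1mx -{1}LP -(mulmxA _ P R) PR mulmx1.
Qed.


Lemma cong_eq (F : divInv) n (M N : 'M[F]_n) : M = N -> cong M N.
Proof. by move->; exact: cong_refl. Qed.

Section UnitRows.
Variables (m n : nat) (u : 'rV[E]_m) (v : 'rV[E]_n).
Hypotheses (hu : @unit_entries D m u) (hv : @unit_entries D n v).

Lemma unit_row : @unit_entries D (m + n) (row_mx u v).
Proof. by move=> i; case: (split_ordP i) => j ->; rewrite ?row_mxEl ?row_mxEr. Qed.

Lemma isom_unit_row :
  isometric (unit_diagf unit_row) (osum (unit_diagf hu) (unit_diagf hv)).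
Proof. exact: (@cong_eq E _ _ _ (diag_mx_row u v)). Qed.

Lemma isom_res_row :
  isometric (res_diagf unit_row) (osum (res_diagf hu) (res_diagf hv)).
Proof.
apply: (@cong_eq B _ _ _ _).
by rewrite -[RHS]diag_mx_row; congr diag_mx; exact: map_row_mx.
Qed.

End UnitRows.

Lemma sym_unit_opp (c : D) : sym_unit c -> sym_unit (- c).
Proof. by move=> [h1 h2 h3]; split; rewrite ?ivconjN ?h1 ?oppr_eq0 ?valdN. Qed.

Lemma unit_opp n (u : 'rV[E]_n) : @unit_entries D n u -> @unit_entries D n (- u).
Proof. by move=> hu i; rewrite mxE; exact: sym_unit_opp (hu i). Qed.

Lemma diag_mxN (R : pzRingType) n (u : 'rV[R]_n) : diag_mx (- u) = - diag_mx u.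
Proof. by apply/matrixP => i j; rewrite !mxE mulNrn. Qed.

Lemma isom_unit_opp n (u : 'rV[E]_n) (hu : @unit_entries D n u) :
  isometric (unit_diagf (unit_opp hu)) (Defs.oppf (unit_diagf hu)).
Proof. exact: (@cong_eq E _ _ _ (diag_mxN u)). Qed.

Lemma isom_res_opp n (u : 'rV[E]_n) (hu : @unit_entries D n u) :
  isometric (res_diagf (unit_opp hu)) (Defs.oppf (res_diagf hu)).
Proof.
apply: (@cong_eq B _ _ _ _); rewrite -[RHS]diag_mxN; congr diag_mx.
by apply/matrixP => i j; rewrite !mxE redN ?(unit_entries_int hu).
Qed.

Lemma unit_ones n : @unit_entries D n (const_mx 1).
Proof.
by move=> i; rewrite mxE oner_neq0 vald1; split=> //; exact: (@conj1 E).
Qed.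

Arguments unit_ones n : clear implicits.

(** The diagonal model of n hyperbolic planes, n times 1 and n times -1. *)
Definition unit_hyp n := unit_row (unit_ones n) (unit_opp (unit_ones n)).

Arguments unit_hyp n : clear implicits.

Lemma isom_unit_hyp n : isometric (unit_diagf (unit_hyp n)) (hyp E n).
Proof.
apply: isom_trans (isom_unit_row _ _) _.
apply: isom_trans (isom_osumN (unit_diagf (unit_ones n))).
exact: isom_osum (isom_refl _) (isom_unit_opp _).
Qed.

Lemma isom_res_hyp n : isometric (res_diagf (unit_hyp n)) (hyp B n).
Proof.
apply: isom_trans (isom_res_row _ _) _.
apply: isom_trans (isom_osumN (res_diagf (unit_ones n))).
exact: isom_osum (isom_refl _) (isom_res_opp _).
Qed.

(** Witt equivalence is isometry after adding hyperbolic planes, and these have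
    diagonal models with unit entries, so that the isometry lifts. *)
Lemma unit_class_of_res m n (u : 'rV[E]_m) (v : 'rV[E]_n)
    (hu : @unit_entries D m u) (hv : @unit_entries D n v) :
  witt_class (res_diagf hu) = witt_class (res_diagf hv) ->
  witt_class (unit_diagf hu) = witt_class (unit_diagf hv).
Proof.
move=> /witt_classP[p [q e]]; apply/witt_classP; exists p, q.
have Tr k (w : 'rV[E]_k) (hw : @unit_entries D k w) l :
    isometric (res_diagf (unit_row hw (unit_hyp l))) (osum (res_diagf hw) (hyp B l)).
  exact: isom_trans (isom_res_row _ _) (isom_osum (isom_refl _) (isom_res_hyp _)).
have Tu k (w : 'rV[E]_k) (hw : @unit_entries D k w) l :
    isometric (unit_diagf (unit_row hw (unit_hyp l))) (osum (unit_diagf hw) (hyp E l)).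
  exact: isom_trans (isom_unit_row _ _) (isom_osum (isom_refl _) (isom_unit_hyp _)).
apply: isom_trans (isom_sym (Tu _ _ hu p)) _; apply: isom_trans (Tu _ _ hv q).
apply: isometry_lift; apply: isom_trans (Tr _ _ hu p) _.
exact: isom_trans e (isom_sym (Tr _ _ hv q)).
Qed.

(** Scaled so that its largest coordinate is 1, an isotropic vector is integral and
    nonzero modulo the maximal ideal. *)
Lemma unit_isotropic n (u : 'rV[E]_n) (hu : @unit_entries D n u) :
  isotropic (gram (unit_diagf hu)) -> isotropic (gram (res_diagf hu)).
Proof.
move=> /= [x x0 ux].
have [j0 xj0] : exists j, x j 0 != 0.
  apply/existsP; apply: contraNT x0; rewrite negb_exists => /forallP x0.
  apply/eqP/colP => j; rewrite mxE; apply/eqP; have := x0 j.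
  by rewrite negbK.
case: (@Order.TotalTheory.arg_minP _ rat _ j0 (fun j => x j 0 != 0)
  (fun j => vald (x j 0 : D)) xj0) => j xj jmin.
have [h1 h2] := divInv_mulV xj.
pose y := x *m ((x j 0)^-1)%:M.
have ey i : y i 0 = x i 0 * (x j 0)^-1.
  by rewrite !mxE big_ord1 !mxE eqxx mulr1n.
have iy : intmx y.
  move=> i k; rewrite ord1 ey /in_O; have [->|xi] := eqVneq (x i 0) 0.
    by rewrite mul0r eqxx.
  by rewrite valdM ?invr_eq0 // valdV // subr_ge0 jmin ?orbT.
have uy : val_at (diag_mx u) y = 0 by rewrite val_atM ux mulmx0 mul0mx.
exists (redmx y).
  apply/eqP => /matrixP/(_ j 0); rewrite mxE ey h1 mxE red1 => /eqP.
  by rewrite oner_eq0.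
have iu := intmx_diag (unit_entries_int hu).
rewrite /val_at -redmx_ctr // -/(redmx u) -redmx_diag -!redmx_mul //.
- rewrite -/(val_at _ _) uy; apply/matrixP => i k; by rewrite !mxE red0.
- by apply: intmx_mul => //; apply: intmx_ctr.
- exact: intmx_ctr.
Qed.

(** The average of any lift and its conjugate is symmetric; 2 is a unit because it
    is nonzero in the residue algebra. *)
Lemma lift_sym_unit (e : B) : invol e = e -> e != 0 ->
  exists2 c : D, sym_unit c & red c = e.
Proof.
move=> he e0; pose x := res_lift e; have xO : in_O x := lift_O e.
have two : @red D (1 + 1) = 1 + 1 by rewrite redD ?in_O1.
have u2 : sym_unit (1 + 1 : D).
  apply: red_sym_unit; last by rewrite two; exact: (@two_neq0 B).
    by rewrite ivconjD; congr (_ + _); exact: (@conj1 E).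
  by rewrite in_O_add ?in_O1.
have uh := sym_unit_inv u2; have [hO _] := sym_unit_red uh.
have [_ n2 _] := u2; have [hh _ _] := uh.
have sO : in_O (x + ivconj x) by rewrite in_O_add ?in_O_conj.
have comm : (1 + 1)^-1 * (x + ivconj x) = (x + ivconj x) * (1 + 1)^-1.
  exact: (@half_comm E).
have ec : red ((x + ivconj x) * (1 + 1)^-1) = e.
  have exc : red (ivconj x) = e by rewrite -red_conj // Defs.liftK.
  rewrite redM // redD ?in_O_conj // exc Defs.liftK.
  rewrite -[e in X in (X + _) * _]mulr1 -[X in (_ + X) * _]mulr1 -mulrDr -two.
  rewrite -mulrA -redM ?in_O_add ?in_O1 //.
  by rewrite mulrV ?valDiv_field // red1 mulr1.
exists ((x + ivconj x) * (1 + 1)^-1) => //; apply: red_sym_unit.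
- by rewrite ivconjM hh ivconjD ivconjK -comm [ivconj x + x]addrC.
- exact: in_O_mul.
- by rewrite ec.
Qed.

Lemma lift_diag n (w : 'rV[B]_n) : diag_entries w ->
  exists2 u : 'rV[E]_n, @unit_entries D n u & redmx u = w.
Proof.
move=> hw; have /choice[f hf] : forall i, exists c : D, sym_unit c /\ red c = w 0 i.
  by move=> i; have [h1 h2] := hw i; have [c] := lift_sym_unit h1 h2; exists c.
exists (\row_i f i); first by move=> i; rewrite mxE; have [] := hf i.
by apply/rowP => i; rewrite !mxE; have [] := hf i.
Qed.

Lemma form_diagonal (F : divInv) (h : hform F) :
  exists (u : 'rV[F]_(dimf h)) (hu : diag_entries u), isometric h (diagf hu).
Proof.
by have [u [hu c]] := diagonalization (gram_herm h) (gram_nondeg h); exists u, hu.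
Qed.

Lemma res_form_unit (h : hform B) :
  exists (u : 'rV[E]_(dimf h)) (hu : @unit_entries D _ u), isometric h (res_diagf hu).
Proof.
have [w [hw c]] := form_diagonal h; have [u hu e] := lift_diag hw.
exists u, hu; apply: isom_trans c _; apply: (@cong_eq B _ _ _ _).
exact: (congr1 (@diag_mx B _) (esym e)).
Qed.

(** An anisotropic representative of the reduction of u lifts to a form in the
    class of u that is still anisotropic; being of class 0, it has dimension 0. *)
Lemma res_class0 n (u : 'rV[E]_n) (hu : @unit_entries D n u) :
  witt_class (unit_diagf hu) = 0 -> witt_class (res_diagf hu) = 0.
Proof.
move=> u0; have [h [ah eh]] := aniso_representative (res_diagf hu).
have [w [hw iw]] := res_form_unit h.
have ew : witt_class (res_diagf hu) = witt_class (res_diagf hw).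
  by rewrite eh; exact/witt_classP/isom_witt.
have aw : ~ isotropic (gram (unit_diagf hw)).
  by move=> /unit_isotropic i; apply: ah; exact: cong_isotropic (isom_sym iw) i.
have w0 : witt_class (unit_diagf hw) = 0.
  by rewrite -u0; apply: unit_class_of_res; rewrite ew.
by rewrite eh; apply: dim0_class; exact: (aniso_class0 aw w0).
Qed.

Lemma res_class_of_unit m n (u : 'rV[E]_m) (v : 'rV[E]_n)
    (hu : @unit_entries D m u) (hv : @unit_entries D n v) :
  witt_class (unit_diagf hu) = witt_class (unit_diagf hv) ->
  witt_class (res_diagf hu) = witt_class (res_diagf hv).
Proof.
move=> e; apply/eqP; rewrite -subr_eq0; apply/eqP.
pose r := unit_row hu (unit_opp hv).
have er : witt_class (res_diagf r) = witt_class (res_diagf hu) - witt_class (res_diagf hv).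
  rewrite -witt_classB; apply/witt_classP/isom_witt.
  exact: isom_trans (isom_res_row _ _) (isom_osum (isom_refl _) (isom_res_opp _)).
rewrite -er; apply: res_class0.
have -> : witt_class (unit_diagf r) = witt_class (unit_diagf hu) - witt_class (unit_diagf hv).
  rewrite -witt_classB; apply/witt_classP/isom_witt.
  exact: isom_trans (isom_unit_row _ _) (isom_osum (isom_refl _) (isom_unit_opp _)).
by rewrite e subrr.
Qed.

Lemma all_unramified (h : hform E) : unramified h.
Proof.
have [u [hu iu]] := form_diagonal h.
have /choice[f hf] : forall i, exists d : D, d != 0 /\
    vald (ivconj d * u 0 i * d) = 0.
  by move=> i; have [h1 h2] := hu i; have [d d0 dv] := unit_scaling h1 h2; exists d.
pose v : 'rV[E]_(dimf h) := \row_i (ivconj (f i) * u 0 i * f i).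
have hv : @unit_entries D _ v.
  move=> i; have [h1 h2] := hu i; have [d0 dv] := hf i; rewrite mxE; split=> //.
    by rewrite !ivconjM ivconjK [ivconj (u 0 i)]h1 mulrA.
  by rewrite !valDiv_mulf ?ivconj_eq0.
exists (dimf h), v, hv; apply: isom_trans iu _.
pose P : 'M[E]_(dimf h) := diag_mx (\row_i f i).
pose Q : 'M[E]_(dimf h) := diag_mx (\row_i (f i)^-1).
have [PQ QP] : P *m Q = 1%:M /\ Q *m P = 1%:M.
  rewrite !mulmx_diag; split; apply/matrixP => i j; rewrite !mxE;
    have [d0 _] := hf i; have [e1 e2] := divInv_mulV (d0 : (f i : E) != 0);
    by case: (i == j); rewrite ?mulr1n ?e1 ?e2.
exists P, Q; split=> //.
have -> : ctr P = diag_mx (\row_i ivconj (f i) : 'rV[E]_(dimf h)).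
  by apply/matrixP => i j; rewrite !mxE eq_sym; case: eqVneq => [->|_] //; rewrite ?mulr1n ?mulr0n ?(@conj0 E).
rewrite [gram _]/(diag_mx v) [X in _ *m X *m _]/(diag_mx u) !mulmx_diag.
by congr diag_mx; apply/rowP => i; rewrite !mxE.
Qed.

Lemma unit_diagonal_exists (h : hform E) : exists g : witt B,
  exists n (u : 'rV[E]_n) (hu : @unit_entries D n u),
    isometric h (unit_diagf hu) /\ g = witt_class (res_diagf hu).
Proof.
have [n [u [hu e]]] := all_unramified h.
by exists (witt_class (res_diagf hu)), n, u, hu.
Qed.

(** A diagonalization of a representative is chosen arbitrarily. *)
Definition larmour (w : witt E) : witt B := projT1 (cid (unit_diagonal_exists (repr w))).

Lemma larmourE : is_larmour larmour.
Proof.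
move=> h n u hu e; rewrite /larmour; case: cid => g /= [m [v [hv [e' ->]]]].
apply: res_class_of_unit; transitivity (witt_class h); last exact/witt_classP/isom_witt.
rewrite -[RHS]witt_classK; exact/witt_classP/isom_witt/isom_sym.
Qed.

Lemma unit_class (w : witt E) : exists n (u : 'rV[E]_n) (hu : @unit_entries D n u),
  w = witt_class (unit_diagf hu).
Proof.
have [n [u [hu e]]] := all_unramified (repr w); exists n, u, hu.
by rewrite -[LHS]witt_classK; exact/witt_classP/isom_witt.
Qed.

Lemma larmour_unit n (u : 'rV[E]_n) (hu : @unit_entries D n u) :
  larmour (witt_class (unit_diagf hu)) = witt_class (res_diagf hu).
Proof. exact: larmourE (isom_refl _). Qed.

Lemma larmour_sub : zmod_morphism larmour.
Proof.
move=> w w'; have [m [u [hu ->]]] := unit_class w.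
have [n [v [hv ->]]] := unit_class w'.
rewrite !larmour_unit -!witt_classB.
transitivity (witt_class (res_diagf (unit_row hu (unit_opp hv)))); last first.
  apply/witt_classP/isom_witt.
  exact: isom_trans (isom_res_row _ _) (isom_osum (isom_refl _) (isom_res_opp _)).
apply: larmourE; apply: isom_sym.
exact: isom_trans (isom_unit_row _ _) (isom_osum (isom_refl _) (isom_unit_opp _)).
Qed.

HB.instance Definition _ :=
  GRing.isZmodMorphism.Build (witt E) (witt B) larmour larmour_sub.

Lemma larmour_bij : bijective larmour.
Proof.
have inj : injective larmour.
  move=> w w'; have [m [u [hu ->]]] := unit_class w.
  have [n [v [hv ->]]] := unit_class w'.
  by rewrite !larmour_unit; exact: unit_class_of_res.
have /choice[g gK] : forall w, exists w', larmour w' = w.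
  move=> w; have [u [hu e]] := res_form_unit (repr w).
  exists (witt_class (unit_diagf hu)); rewrite larmour_unit -[RHS]witt_classK.
  exact/witt_classP/isom_witt/isom_sym.
by exists g => // w; apply: inj; rewrite gK.
Qed.

Theorem larmour_isomorphism : exists d : {additive witt E -> witt B},
  is_larmour d /\ bijective d.
Proof. by exists larmour; split; [exact: larmourE | exact: larmour_bij]. Qed.

End Larmour.

(** * The quaternion algebra (a, pi / K) *)

Lemma rank2_commutative (R : nzRingType) (k : Type) (i : k -> R) (X : R) :
  (forall c d, i c * i d = i d * i c) -> (forall c, i c * X = X * i c) ->
  (forall e, exists c : k * k, e = i c.1 + i c.2 * X) -> commutative (@GRing.mul R).
Proof.
move=> ii ix dec.
have gen f : (forall c, GRing.comm f (i c)) -> GRing.comm f X ->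
    forall e, GRing.comm f e.
  by move=> fi fX e; have [c ->] := dec e; exact: (commrD (fi _) (commrM (fi _) fX)).
have gi c : forall e, GRing.comm (i c) e by apply: gen => [d|]; [exact: ii | exact: ix].
have gX : forall e, GRing.comm X e.
  by apply: gen => // c; exact: commr_sym (ix c).
by move=> e; apply: gen => [c|]; apply: commr_sym; [exact: gi | exact: gX].
Qed.

Section QuaternionResidue.
Variable K : cdvField.
Hypothesis hk : 2%N \notin [pchar (resfield K)].
Variables a pi : K.
Hypotheses (ha : cdv_unit_elt a) (hpi : uniformizer pi).
Local Notation Q := (quat a pi).
Hypothesis hD : forall d : Q, d != 0 -> d \is a GRing.unit.
Local Notation D := (quat_ivd hk ha hpi hD).
Local Notation i := (k_incl hk ha hpi hD).
Local Notation xbar := (@red D (qx a pi)).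
Local Notation nge := (nu_ge (@nu K)).

Lemma half_intr_ge (n m : int) : ((n%:~R / 2%:R : rat) <= m%:~R / 2%:R) = (n <= m).
Proof. by rewrite ler_pM2r ?invr_gt0 // ler_int. Qed.

Lemma half_intr_gt (n m : int) : ((n%:~R / 2%:R : rat) < m%:~R / 2%:R) = (n < m).
Proof. by rewrite ltr_pM2r ?invr_gt0 // ltr_int. Qed.

Lemma Nrd_eq0 (d : Q) : (Nrd d == 0) = (d == 0).
Proof.
apply/eqP/eqP => [e|->]; last by rewrite /Nrd /=; ring.
by apply/eqP; apply: contraT => /hD; rewrite quat_unitE e eqxx.
Qed.

Lemma in_O_Nrd (d : D) : in_O d = nge 0 (Nrd (d : Q)).
Proof.
rewrite /in_O /nu_ge Nrd_eq0 /vald /= /nuD; congr (_ || _).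
by rewrite -(half_intr_ge 0) mul0r.
Qed.

Lemma in_m_Nrd (d : D) : in_m d = nge 1 (Nrd (d : Q)).
Proof.
rewrite /in_m /nu_ge Nrd_eq0 /vald /= /nuD; congr (_ || _).
by rewrite -{1}(mul0r (2%:R)^-1) (half_intr_gt 0).
Qed.

Lemma two_neq0K : (2%:R : K) != 0.
Proof. by have /andP[] := two_unit hk. Qed.

(** The other coordinates equal their opposites, and 2 is nonzero. *)
Lemma conj_fixed (d : Q) : qconj d = d -> d = (qc0 d)%:A.
Proof.
case: d => [d0 d1 d2 d3] [e1 e2 e3].
have z (x : K) : - x = x -> x = 0.
  move=> /eqP; rewrite eq_sym -addr_eq0 -mulr2n -mulr_natl mulf_eq0.
  by rewrite (negPf two_neq0K) => /eqP.
by apply: quatP; rewrite /= ?mulr1 ?mulr0 // (z _ e1, z _ e2, z _ e3).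
Qed.

Lemma sym_unit_scalar (d : D) : sym_unit d ->
  exists2 t : K, cdv_unit_elt t & d = (t%:A : Q).
Proof.
move=> [/conj_fixed e]; move: e; move: (qc0 _) => t ->.
rewrite [_ == _]scalarA_eq0 => t0; rewrite /vald /= (nuD_scalar a pi) // => /eqP.
by rewrite intr_eq0 => tv; exists t; rewrite // /cdv_unit_elt t0.
Qed.

(** For scalars s and t with the same residue, t / s is congruent to 1 and so the
    square of some l in K; then l s l = t. *)
Lemma quat_hensel (c v : D) : sym_unit c -> sym_unit v -> red c = red v ->
  exists d : D, ivconj d * c * d = v.
Proof.
move=> uc uv; have [[cO _] [vO _]] := (sym_unit_red uc, sym_unit_red uv).
move=> /(redP cO vO); have [s us ->] := sym_unit_scalar uc.
have [t ut ->] := sym_unit_scalar uv => st.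
have {}st : nge 1 (s - t).
  have {}st : @in_m D ((s - t)%:A : Q) by rewrite scalerBl.
  move: st; rewrite [in_m _](in_m_scalar hk ha hpi hD (s - t)).
  rewrite /in_m /nu_ge /vald /= /nuQ ltr0z.
  by [].
have /andP[s0 /eqP sv] := us; have /andP[t0 /eqP tv] := ut.
have [|||l el] := @hensel_sqrt K (two_unit hk) (t / s) 1.
- by rewrite /cdv_unit_elt mulf_neq0 ?invr_eq0 // nu_mul ?invr_eq0 // nuV // sv tv.
- by rewrite /nu_ge nu1 lexx orbT.
- have -> : 1 ^+ 2 - t / s = (s - t) * s^-1 by field.
  by rewrite -[1]addr0; apply: nge_mul => //; rewrite /nu_ge nuV // sv lexx orbT.
exists (l%:A : Q); apply: quatP; rewrite /=.
- transitivity (l ^+ 2 * s); first by ring.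
  by rewrite el; field.
all: by ring.
Qed.

Lemma vald_qy : vald (qy a pi : D) = 1 / 2%:R.
Proof.
have /andP[pi0 /eqP piv] := hpi.
rewrite /vald /= /nuD; have -> : Nrd (qy a pi) = - pi by rewrite /Nrd /=; ring.
by rewrite nuN piv.
Qed.

(** Powers of y. *)
Lemma half_valued (n : int) : exists2 d : D, d != 0 & vald d = n%:~R / 2%:R.
Proof.
have y0 : (qy a pi : D) != 0 by apply/eqP => -[/eqP]; rewrite oner_eq0.
have nat_case (m : nat) : exists2 d : D, d != 0 & vald d = m%:R / 2%:R.
  elim: m => [|m [d d0 dv]]; first by exists 1; rewrite ?oner_neq0 // vald1 mul0r.
  exists (d * qy a pi); first exact: valDiv_mulf.
  by rewrite valdM // dv vald_qy -mulrDl natr1.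
case: n => m; first exact: nat_case.
have [d d0 dv] := nat_case m.+1; exists d^-1; first by rewrite invr_eq0.
by rewrite valdV // dv NegzE mulrNz mulNr.
Qed.

Lemma quat_unit_scaling (c : D) : ivconj c = c -> c != 0 ->
  exists2 d, d != 0 & vald (ivconj d * c * d) = 0.
Proof.
move=> /conj_fixed; move: (qc0 _) => t -> c0.
have t0 : t != 0 by move: c0; rewrite [_ == _]scalarA_eq0.
have [d d0 dv] := half_valued (- nu t); exists d => //.
have cd0 := ivconj_eq0 d; rewrite !valdM ?valDiv_mulf ?cd0 // vald_conj dv.
have -> : @vald D (t%:A : Q) = (nu t)%:~R by exact: nuD_scalar.
by rewrite mulrNz; field.
Qed.

Lemma qx_in_O : @in_O D (qx a pi).
Proof.
have /andP[a0 /eqP av] := ha.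
rewrite in_O_Nrd; have -> : Nrd (qx a pi) = - a by rewrite /Nrd /=; ring.
by rewrite /nu_ge nuN av lexx orbT.
Qed.

Lemma red_plane (s t : K) : @in_O (cdv_val K) s -> @in_O (cdv_val K) t ->
  @red D (Quat a pi s t 0 0) = i (cdv_res s) + i (cdv_res t) * xbar.
Proof.
move=> sO tO; rewrite !k_incl_red // -redM ?in_O_scalar ?qx_in_O //.
rewrite -redD ?in_O_scalar ?in_O_mul ?qx_in_O ?in_O_scalar //.
by congr red; apply: quatP => /=; ring.
Qed.

(** The condition nu (Nrd d) >= 0 is a condition on the separate coordinates, so it
    passes to each component of d. The reduced norm of a nonzero component on y
    and z has odd valuation, hence positive valuation once it is integral. *)
Lemma in_O_parts (d : D) : in_O d -> [/\ @in_O (cdv_val K) (qc0 (d : Q)),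
  @in_O (cdv_val K) (qc1 (d : Q)) & in_m (d - Quat a pi (qc0 (d : Q)) (qc1 (d : Q)) 0 0)].
Proof.
rewrite in_O_Nrd; have [c [c' [h1 h2]]] := Nrd_ge hk ha hpi hD 0.
move=> /h1[g0 g1 g2 g3].
have z n : nge n 0 by exact: nge0.
have [O0 O1 O2] : [/\ @in_O D (Quat a pi (qc0 (d : Q)) 0 0 0),
    @in_O D (Quat a pi 0 (qc1 (d : Q)) 0 0) &
    @in_O D (Quat a pi 0 0 (qc2 (d : Q)) (qc3 (d : Q)))].
  by split; rewrite in_O_Nrd; apply: h2.
split.
- rewrite -(in_O_scalar hk ha hpi hD); move: O0; congr (is_true (in_O _)).
  by apply: quatP; rewrite /= ?mulr1 ?mulr0.
- rewrite -(in_O_scalar hk ha hpi hD).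
  have x0 : (qx a pi : D) != 0 by apply/eqP => -[/eqP]; rewrite oner_eq0.
  have vx : vald (qx a pi : D) = 0.
    have /andP[a0 /eqP av] := ha; rewrite /vald /= /nuD.
    have -> : Nrd (qx a pi) = - a by rewrite /Nrd /=; ring.
    by rewrite nuN av mul0r.
  have xV : @in_O D (qx a pi)^-1 by rewrite /in_O valdV // vx oppr0 lexx orbT.
  have := in_O_mul O1 xV; congr (is_true (in_O _)).
  have -> : Quat a pi 0 (qc1 (d : Q)) 0 0 = (qc1 (d : Q))%:A * qx a pi :> Q.
    by apply: quatP => /=; ring.
  by rewrite mulrK // (valDiv_field x0).
have -> : d - Quat a pi (qc0 (d : Q)) (qc1 (d : Q)) 0 0 =
    Quat a pi 0 0 (qc2 (d : Q)) (qc3 (d : Q)) :> Q.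
  by apply: quatP => /=; ring.
move: O2; rewrite in_O_Nrd in_m_Nrd /=; set p := qc2 _; set q := qc3 _.
have -> : Nrd (Quat a pi 0 0 p q) = - pi * (p ^+ 2 - a * q ^+ 2).
  by rewrite /Nrd /=; ring.
have [pq0|] := boolP ((p != 0) || (q != 0)).
  have [m [n0 nv _ _]] := norm_val hk ha hpi hD pq0.
  have /andP[pi0 /eqP piv] := hpi.
  have ne : - pi * (p ^+ 2 - a * q ^+ 2) != 0 by rewrite mulf_neq0 ?oppr_eq0.
  rewrite /nu_ge (negPf ne) nu_mul ?oppr_eq0 // nuN piv nv /=.
  by clear; lia.
rewrite negb_or !negbK => /andP[/eqP-> /eqP->] _.
by rewrite expr0n /= mulr0 subr0 mulr0 z.
Qed.

(** The valuation of s^2 - a t^2 is even and bounds those of s and t, so being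
    positive it forces s and t into the maximal ideal. *)
Lemma red_xbar_eq0 (s t : K) : @in_O (cdv_val K) s -> @in_O (cdv_val K) t ->
  i (cdv_res s) + i (cdv_res t) * xbar = 0 -> cdv_res s = 0 /\ cdv_res t = 0.
Proof.
move=> sO tO; rewrite -red_plane // => /eqP.
have dO : @in_O D (Quat a pi s t 0 0).
  have -> : Quat a pi s t 0 0 = s%:A + t%:A * qx a pi :> Q.
    by apply: quatP => /=; ring.
  by rewrite in_O_add ?in_O_mul ?in_O_scalar ?qx_in_O.
rewrite red_eq0 // in_m_Nrd.
have -> : Nrd (Quat a pi s t 0 0) = s ^+ 2 - a * t ^+ 2 by rewrite /Nrd /=; ring.
have [st0|] := boolP ((s != 0) || (t != 0)).
  have [m [n0 nv gs gt]] := norm_val hk ha hpi hD st0.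
  rewrite /nu_ge (negPf n0) nv /= => m1.
  have gem (r : K) : @in_O (cdv_val K) r -> nge m r -> cdv_res r = 0.
    move=> rO gr; apply/eqP; rewrite [_ == 0]red_eq0 //.
    have : nge 1 r by apply: nge_le gr; move: m1; clear; lia.
    by rewrite /in_m /nu_ge /vald /= /nuQ ltr0z.
  by split; apply: gem.
rewrite negb_or !negbK => /andP[/eqP-> /eqP->] _.
by rewrite /cdv_res red0.
Qed.

Lemma cdv_res_surj (c : resfield K) :
  exists2 t : K, @in_O (cdv_val K) t & cdv_res t = c.
Proof.
have [t tO et] := @red_surj (cdv_val K) c.
by exists t.
Qed.

Lemma residue_decomposition (e : residue D) :
  exists c : resfield K * resfield K, e = i c.1 + i c.2 * xbar.
Proof.
have [d dO <-] := red_surj e; have [O0 O1 dm] := in_O_parts dO.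
exists (cdv_res (qc0 (d : Q)), cdv_res (qc1 (d : Q))) => /=.
rewrite -red_plane //; apply/redP => //.
by rewrite -(subrK d (Quat _ _ _ _ _ _ : D)) in_O_add // in_m_O // -in_m_opp opprB.
Qed.

Lemma k_incl_inj2 (c c' : resfield K * resfield K) :
  i c.1 + i c.2 * xbar = i c'.1 + i c'.2 * xbar -> c = c'.
Proof.
case: c c' => [c1 c2] [d1 d2] /= e.
have : i (c1 - d1) + i (c2 - d2) * xbar = 0.
  by rewrite !rmorphB mulrBl addrACA -opprD e subrr.
have lK (f : resfield K) : cdv_res (res_lift f : K) = f := Defs.liftK f.
rewrite -(lK (c1 - d1)) -(lK (c2 - d2)) => /red_xbar_eq0[||]; try exact: lift_O.
by rewrite !lK => /eqP; rewrite subr_eq0 => /eqP-> /eqP; rewrite subr_eq0 => /eqP->.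
Qed.

Lemma residue_comm : commutative (@GRing.mul (residue D)).
Proof.
apply: (@rank2_commutative _ (resfield K) i xbar) => [c d|c|].
- by rewrite -[LHS](rmorphM i) -[RHS](rmorphM i) mulrC.
- have [t tO <-] := cdv_res_surj c.
  rewrite (k_incl_red hk ha hpi hD tO) -!redM ?in_O_scalar ?qx_in_O //.
  by congr red; apply: quatP => /=; ring.
- exact: residue_decomposition.
Qed.

Lemma residue_quadratic : @quadratic_ext (resfield K) (ivres D) i xbar (cdv_res a).
Proof.
have /andP[a0 /eqP av] := ha.
split.
- exact: residue_comm.
- move=> e; have [c ec] := residue_decomposition e; exists c; split=> // c' ec'.
  by apply: k_incl_inj2; rewrite -ec.
- have aO : @in_O (cdv_val K) a by rewrite /in_O /vald /= /nuQ av lexx orbT.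
  transitivity (@red D (a%:A : Q)); last exact/esym/k_incl_red.
  by rewrite expr2 -[LHS]redM ?qx_in_O // -expr2; congr red; exact: qx2.
- move=> c; have [t tO <-] := cdv_res_surj c.
  have e : i (cdv_res t) = @red D (t%:A : Q) by exact: k_incl_red.
  have tD : @in_O D (t%:A : Q) by rewrite in_O_scalar.
  have st : qconj (t%:A : Q) = t%:A by apply: quatP; rewrite /= ?mulr0 ?oppr0.
  transitivity (res_conj (@red D (t%:A : Q))); first exact: (congr1 _ e).
  apply: etrans (esym e); rewrite red_conj //; congr red; exact: st.
- rewrite [LHS]red_conj ?qx_in_O // -[RHS]redN ?qx_in_O //.
  by congr red; apply: quatP; rewrite /= ?oppr0.
Qed.

End QuaternionResidue.

Theorem mainTheorem10 (K : cdvField) (hk : 2%N \notin [pchar (resfield K)])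
    (a pi : K) (ha : cdv_unit_elt a) (hpi : uniformizer pi)
    (hD : forall d : quat a pi, d != 0 -> d \is a GRing.unit) :
  let D : invValDiv := quat_ivd hk ha hpi hD in
  let xbar : residue D := @red D (qx a pi) in
  [/\ forall h : hform (ivdiv D), unramified h,
      @quadratic_ext (resfield K) (ivres D) (k_incl hk ha hpi hD) xbar
        (cdv_res a) &
      exists d0 : {additive witt (ivdiv D) -> witt (ivres D)},
        [/\ is_larmour d0,
            bijective d0 &
            forall (delta : K) (hdelta : cdv_unit_elt delta),
              d0 (witt_class (scalar_form hk ha hpi hD hdelta)) =
              witt_class (res_scalar_form hk ha hpi hD hdelta)]].
Proof.
move=> D xbar.
have hens := @quat_hensel K hk a pi ha hpi hD.
have scal := @quat_unit_scaling K hk a pi ha hpi hD.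
split; [exact: all_unramified scal | exact: residue_quadratic |].
have [d0 [lar bij]] := larmour_isomorphism hens scal.
exists d0; split=> // delta hdelta; have /andP[d_0 /eqP dv] := hdelta.
have hu : @unit_entries D 1 (\row_(i < 1) (delta%:A : quat a pi)).
  move=> i; have [h1 h2] := scalar_entries hk ha hpi hD hdelta i; split=> //.
  by rewrite mxE [vald _](nuD_scalar a pi d_0) dv.
have iso : isometric (scalar_form hk ha hpi hD hdelta) (unit_diagf hu).
  exact: isom_refl.
rewrite (lar _ _ _ hu iso); apply/witt_classP/isom_witt.
apply: (@cong_eq (ivres D) _ _ _ _); congr diag_mx.
apply/rowP => i; rewrite !mxE k_incl_red //.
by rewrite /in_O /vald /= /nuQ dv lexx orbT.
Qed.
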